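(* Let $Z\subseteq R\subseteq S\subseteq \mathrm{Q}(R)$ be commutative rings, each a subring of the next, such that $Z$ is Dedekind and $S$ is finitely generated as a $Z$-module. Let $\mathfrak{a}\subseteq R$ be an invertible ideal of $R$ contained in $R$ and let $m\in\mathbb{Z}_{\geq 0}$. Write $a=\mathfrak{a}\cap Z$ and suppose that $R/\mathfrak{a}$ is finite-étale over $Z/a$. If there exists an ideal $\mathfrak{b}\subseteq S$ of $S$ with $S\mathfrak{a}=\mathfrak{b}^m$, then there exists an ideal $b\subseteq Z$ of $Z$ with $a=b^m$.
   Context: $\mathrm{Q}(R)$ denotes the total ring of fractions of the commutative ring $R$, obtained by inverting all regular elements (non-zero-divisors); $R$ is identified with its image. An invertible ideal of $R$ is an $R$-submodule $\mathfrak{a}\subseteq\mathrm{Q}(R)$ for which there exists an $R$-submodule $\mathfrak{b}\subseteq\mathrm{Q}(R)$ with $\mathfrak{a}\cdot\mathfrak{b}=R$, where $\mathfrak{a}\cdot\mathfrak{b}$ is the $R$-module generated by all products. Zeroth powers of ideals of a ring equal the ring itself. Dedekind means Noetherian integrally closed domain of Krull dimension at most $1$ (fields allowed). A commutative $A$-algebra $B$ is separable if $B$ is projective as a $(B\otimes_A B)$-module (via multiplication), and finite-étale if it is projective as an $A$-module and separable over $A$. *)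

(* Defs.v *)
From HB Require Import structures.
From mathcomp Require Import all_boot all_order all_algebra.
From mathcomp Require Import boolp classical_sets.

Set Implicit Arguments.
Unset Strict Implicit.
Unset Printing Implicit Defensive.

Import GRing.Theory.
Local Open Scope classical_set_scope.
Local Open Scope ring_scope.
Local Open Scope quotient_scope.

Definition submod_span (A : pzRingType) (M : lmodType A) (X : set M) :
    {pred M} :=
  fun x => `[< exists n (c : 'I_n -> A) (g : 'I_n -> M),
    (forall i, X (g i)) /\ x = \sum_(i < n) c i *: g i >].

Section Span.
Variables (A : pzRingType) (M : lmodType A) (X : set M).

Lemma submod_span_closed : GRing.subsemimod_closed (submod_span X).
Proof.
split; last first.
  move=> a x /asboolP[n [c [g [gX ->]]]]; apply/asboolP.
  exists n, (fun i => a * c i), g; split=> //.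
  by rewrite scaler_sumr; apply: eq_bigr => i _; rewrite scalerA.
split.
  apply/asboolP; exists 0%N, (fun=> 0), (fun=> 0).
  by split=> [[]//|]; rewrite big_ord0.
move=> x y /asboolP[n [c [g [gX ->]]]] /asboolP[m [d [h [hX ->]]]].
apply/asboolP; exists (n + m)%N,
  (fun i => match split i with inl j => c j | inr j => d j end),
  (fun i => match split i with inl j => g j | inr j => h j end).
split=> [i|]; first by case: (split i).
rewrite big_split_ord /=; congr (_ + _); apply: eq_bigr => i _.
  by rewrite -[lshift _ _]/(unsplit (inl i)) unsplitK.
by rewrite -[rshift _ _]/(unsplit (inr i)) unsplitK.
Qed.

HB.instance Definition _ :=
  GRing.isSubmodClosed.Build A M (submod_span X) submod_span_closed.

End Span.

Definition module_finite (A : pzRingType) (M : lmodType A) : Prop :=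
  exists s : seq M, forall x : M, x \in submod_span [set` s].

Definition projective (A : pzRingType) (P : lmodType A) : Prop :=
  forall (M N : lmodType A) (g : {linear M -> N}) (u : {linear P -> N}),
    (forall y, exists x, g x = y) ->
    exists v : {linear P -> M}, forall p, g (v p) = u p.

(* [restrict f] is B regarded as an A-algebra through f : A -> B. *)
Definition restrict (A B : pzRingType) (f : {rmorphism A -> B}) : Type := B.

Section Restrict.
Variables (A B : pzRingType) (f : {rmorphism A -> B}).

HB.instance Definition _ := GRing.PzRing.on (restrict f).

Definition restrict_scale (a : A) (b : restrict f) : restrict f :=
  (f a : restrict f) * b.

Lemma restrict_scaleA a b x :
  restrict_scale a (restrict_scale b x) = restrict_scale (a * b) x.
Proof. by rewrite /restrict_scale rmorphM mulrA. Qed.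
Lemma restrict_scale1 : left_id 1 restrict_scale.
Proof. by move=> x; rewrite /restrict_scale rmorph1 mul1r. Qed.
Lemma restrict_scaleDr : right_distributive restrict_scale +%R.
Proof. by move=> a x y; rewrite /restrict_scale mulrDr. Qed.
Lemma restrict_scaleDl x : {morph restrict_scale^~ x : a b / a + b}.
Proof. by move=> a b; rewrite /restrict_scale rmorphD mulrDl. Qed.

HB.instance Definition _ := GRing.Zmodule_isLmodule.Build A (restrict f)
  restrict_scaleA restrict_scale1 restrict_scaleDr restrict_scaleDl.

End Restrict.

Section RestrictNz.
Variables (A : pzRingType) (B : nzRingType) (f : {rmorphism A -> B}).

HB.instance Definition _ := GRing.NzRing.on (restrict f).

Lemma restrict_scaleAl (a : A) (x y : restrict f) :
  a *: (x * y) = (a *: x) * y.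
Proof. exact: mulrA. Qed.

HB.instance Definition _ :=
  GRing.Lmodule_isLalgebra.Build A (restrict f) restrict_scaleAl.

End RestrictNz.

Definition ideal (A : comNzRingType) := submodClosed A^o.

Definition unit_ideal (A : comNzRingType) : {pred A^o} := predT.
Arguments unit_ideal A : clear implicits.
Lemma unit_ideal_submod (A : comNzRingType) :
  GRing.subsemimod_closed (unit_ideal A).
Proof. by []. Qed.
HB.instance Definition _ (A : comNzRingType) :=
  GRing.isSubmodClosed.Build A A^o (unit_ideal A) (unit_ideal_submod A).

Definition submod_mul (A : pzRingType) (E : lalgType A)
    (I J : submodClosed E) : submodClosed E :=
  submod_span [set x * y | x in [set` I] & y in [set` J]].

Fixpoint ideal_exp (A : comNzRingType) (I : ideal A) (m : nat) : ideal A :=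
  if m is m'.+1 then submod_mul I (ideal_exp I m') else unit_ideal A.

Definition contraction (A B : comNzRingType) (f : {rmorphism A -> B})
    (J : ideal B) : {pred A^o} := fun x => f x \in J.

Lemma contraction_submod (A B : comNzRingType) (f : {rmorphism A -> B})
  (J : ideal B) : GRing.subsemimod_closed (contraction f J).
Proof.
split; first split.
- by change (f 0 \in J); rewrite rmorph0; exact: (rpred0 J).
- move=> x y; change (f x \in J -> f y \in J -> f (x + y) \in J).
  by rewrite rmorphD; apply: (rpredD (S := J)).
- move=> a x; change (f x \in J -> f (a * x) \in J).
  by rewrite rmorphM; apply: (@rpredZ _ _ J (f a)).
Qed.
HB.instance Definition _ (A B : comNzRingType) (f : {rmorphism A -> B})
    (J : ideal B) :=
  GRing.isSubmodClosed.Build A A^o (contraction f J) (contraction_submod f J).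

Definition extension (A B : comNzRingType) (f : {rmorphism A -> B})
    (I : ideal A) : ideal B :=
  @submod_span B B^o [set f x | x in [set` I]].

(* Q is obtained from R by inverting the regular elements, and R is identified
   with its image under j. *)
Definition is_total_fractions (R Q : comNzRingType) (j : {rmorphism R -> Q}) :
    Prop :=
  [/\ injective j,
      forall s : R, GRing.lreg s -> exists t : Q, j s * t = 1
    & forall x : Q, exists r s : R, GRing.lreg s /\ j s * x = j r].

Definition invertible (R Q : comNzRingType) (j : {rmorphism R -> Q})
    (I : submodClosed (restrict j)) : Prop :=
  exists J : submodClosed (restrict j),
    forall x : Q, x \in submod_mul I J <-> exists r : R, x = j r.

(* The ideal I of R, regarded as an R-submodule of Q. *)
Definition ideal_image (R Q : comNzRingType) (j : {rmorphism R -> Q})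
    (I : ideal R) : submodClosed (restrict j) :=
  @submod_span R (restrict j) [set j x | x in [set` I]].

Definition noetherian (A : comNzRingType) : Prop :=
  forall I : ideal A, exists s : seq A^o, I =i submod_span [set` s].

Definition integrally_closed (A : idomainType) : Prop :=
  forall x : {fraction A}, integralOver (@tofrac A) x ->
    exists a : A, x = tofrac a.

Definition prime_ideal (A : comNzRingType) (I : ideal A) : Prop :=
  1 \notin I /\ @prime_idealr_closed A I.

(* There is no chain of n + 2 primes p 0 < p 1 < ... < p (n + 1). *)
Definition krull_dim_le (A : comNzRingType) (n : nat) : Prop :=
  forall p : nat -> ideal A, (forall i, (i <= n.+1)%N -> prime_ideal (p i)) ->
    ~ (forall i, (i <= n)%N ->
         {subset p i <= p i.+1} /\ ~ {subset p i.+1 <= p i}).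

Definition dedekind (A : idomainType) : Prop :=
  [/\ noetherian A, integrally_closed A & krull_dim_le A 1].

(* MathComp's ring structure on quotients is limited to proper ideals; here
   the quotient by the unit ideal is allowed, and is the zero ring. *)
Section IdealQuotient.
Variables (A : comNzRingType) (I : ideal A).

Definition ideal_pred : {pred A} := I.

Lemma ideal_pred_zmod : zmod_closed ideal_pred.
Proof.
split=> [|x y xI yI]; first exact: (rpred0 I).
rewrite -mulN1r; apply: (rpredD (S := I)) => //; exact: (@rpredZ _ _ I (-1)).
Qed.
HB.instance Definition _ :=
  GRing.isZmodClosed.Build A ideal_pred ideal_pred_zmod.

Definition quot : Type := Quotient.quot ideal_pred.
HB.instance Definition _ := GRing.Zmodule.on quot.
HB.instance Definition _ := EqQuotient.on quot.

Lemma quot_eq (x y : A) : (\pi_quot x = \pi_quot y) <-> (x - y \in I).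
Proof.
by split=> [/eqP|xyI]; [|apply/eqP];
  rewrite -(@Quotient.idealrBE A ideal_pred).
Qed.

Lemma quot_repr (x : A) : repr (\pi_quot x) - x \in I.
Proof. by apply/quot_eq; rewrite reprK. Qed.

Lemma quot_surj (x : quot) : exists a, x = \pi_quot a.
Proof. by exists (repr x); rewrite reprK. Qed.

Definition quot_one : quot := \pi_quot 1.
Definition quot_mul (x y : quot) : quot := \pi_quot (repr x * repr y).

Lemma ideal_mull a x : x \in I -> a * x \in I.
Proof. exact: (@rpredZ _ _ I a). Qed.

Lemma quot_piM (x y : A) :
  \pi_quot (x * y) = quot_mul (\pi_quot x) (\pi_quot y).
Proof.
apply/quot_eq.
set x' := repr (\pi_quot x); set y' := repr (\pi_quot y).
have -> : x * y - x' * y' = - 1 * (y * (x' - x) + x' * (y' - y)).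
  by rewrite mulN1r !mulrBr (mulrC y x') [X in _ = - X]addrC addrA subrK opprB
    (mulrC y).
by apply/ideal_mull/(rpredD (S := I)); apply/ideal_mull/quot_repr.
Qed.

Lemma quot_mulA : associative quot_mul.
Proof.
move=> x y z; have [{}x ->] := quot_surj x.
have [{}y ->] := quot_surj y; have [{}z ->] := quot_surj z.
by rewrite -!quot_piM mulrA.
Qed.
Lemma quot_mulC : commutative quot_mul.
Proof.
move=> x y; have [{}x ->] := quot_surj x.
by have [{}y ->] := quot_surj y; rewrite -!quot_piM mulrC.
Qed.
Lemma quot_mul1 : left_id quot_one quot_mul.
Proof. by move=> x; have [{}x ->] := quot_surj x; rewrite -quot_piM mul1r. Qed.
Lemma quot_piD (x y : A) : \pi_quot (x + y) = \pi_quot x + \pi_quot y :> quot.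
Proof. exact: (@raddfD _ _ \pi_(Quotient.quot ideal_pred)). Qed.
Lemma quot_mulD : left_distributive quot_mul +%R.
Proof.
move=> x y z; have [{}x ->] := quot_surj x.
have [{}y ->] := quot_surj y; have [{}z ->] := quot_surj z.
by rewrite -quot_piD -!quot_piM mulrDl quot_piD.
Qed.
HB.instance Definition _ := GRing.Zmodule_isComPzRing.Build quot
  quot_mulA quot_mulC quot_mul1 quot_mulD.

Lemma quot_pi1 : \pi_quot 1 = 1 :> quot. Proof. by []. Qed.
Lemma quot_piMr (x y : A) :
  \pi_quot (x * y) = \pi_quot x * \pi_quot y :> quot.
Proof. exact: quot_piM. Qed.

End IdealQuotient.

(* The map A / f^-1(J) -> B / J induced by f : A -> B. *)
Section QuotientMap.
Variables (A B : comNzRingType) (f : {rmorphism A -> B}) (J : ideal B).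

Definition quot_map (x : quot (contraction f J)) : quot J :=
  \pi_(quot J) (f (repr x)).

Lemma quot_mapE (x : A) :
  quot_map (\pi_(quot (contraction f J)) x) = \pi_(quot J) (f x).
Proof.
apply/quot_eq; rewrite -rmorphB.
exact: (quot_repr (contraction f J) x).
Qed.

Lemma quot_map_zmod : zmod_morphism quot_map.
Proof.
move=> x y; have [{}x ->] := quot_surj x.
have [{}y ->] := quot_surj y.
have piB (C : comNzRingType) (K : ideal C) (u v : C) :
    \pi_(quot K) u - \pi_(quot K) v = \pi_(quot K) (u - v).
  by apply/eqP; rewrite subr_eq -quot_piD subrK.
by rewrite piB !quot_mapE rmorphB -piB.
Qed.
Lemma quot_map_monoid : monoid_morphism quot_map.
Proof.
split; first by rewrite -[1 in LHS]quot_pi1 quot_mapE rmorph1.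
move=> x y; have [{}x ->] := quot_surj x.
have [{}y ->] := quot_surj y.
by rewrite -quot_piMr !quot_mapE rmorphM quot_piMr.
Qed.
HB.instance Definition _ := GRing.isZmodMorphism.Build
  (quot (contraction f J)) (quot J) quot_map quot_map_zmod.
HB.instance Definition _ := GRing.isMonoidMorphism.Build
  (quot (contraction f J)) (quot J) quot_map quot_map_monoid.

End QuotientMap.
Arguments quot_map {A B} f J x.

(* A list [:: (b1, c1); ..; (bn, cn)] stands for the sum of the bi (x) ci, and
   [tensor_eqv] is the congruence defining B (x)_A C as an abelian group. *)
Section Tensor.
Variables (A B C : comPzRingType).
Variables (f : {rmorphism A -> B}) (g : {rmorphism A -> C}).

Inductive tensor_eqv : seq (B * C) -> seq (B * C) -> Prop :=
| TensorRefl s : tensor_eqv s s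
| TensorSym s t : tensor_eqv s t -> tensor_eqv t s
| TensorTrans s t u : tensor_eqv s t -> tensor_eqv t u -> tensor_eqv s u
| TensorCat s s' t t' :
    tensor_eqv s s' -> tensor_eqv t t' -> tensor_eqv (s ++ t) (s' ++ t')
| TensorCatC s t : tensor_eqv (s ++ t) (t ++ s)
| TensorZero c : tensor_eqv [:: (0, c)] [::]
| TensorDl b b' c : tensor_eqv [:: (b + b', c)] [:: (b, c); (b', c)]
| TensorDr b c c' : tensor_eqv [:: (b, c + c')] [:: (b, c); (b, c')]
| TensorBal a b c : tensor_eqv [:: (f a * b, c)] [:: (b, g a * c)].

Definition tensor_eqvb : rel (seq (B * C)) := fun s t => `[< tensor_eqv s t >].

Lemma tensor_eqvb_equiv : equiv_class_of tensor_eqvb.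
Proof.
split=> [s|s t|t s u]; first exact/asboolP/TensorRefl.
  by apply/asboolP/asboolP; apply: TensorSym.
by move=> /asboolP st /asboolP tu; apply/asboolP; apply: TensorTrans st tu.
Qed.
Canonical tensor_eqvb_rel := EquivRelPack tensor_eqvb_equiv.
Canonical tensor_eqvb_enc := defaultEncModRel tensor_eqvb.

Definition tensor : Type := {eq_quot tensor_eqvb}.
HB.instance Definition _ := Choice.on tensor.
HB.instance Definition _ := EqQuotient.on tensor.

Lemma tensor_eq s t : (\pi_tensor s = \pi_tensor t) <-> tensor_eqv s t.
Proof.
by split=> [/eqP|H]; [rewrite eqmodE => /asboolP|
  apply/eqP; rewrite eqmodE; apply/asboolP].
Qed.

Lemma tensor_surj (x : tensor) : exists s, x = \pi_tensor s.
Proof. by exists (repr x); rewrite reprK. Qed.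

Lemma tensor_repr s : tensor_eqv (repr (\pi_tensor s)) s.
Proof. by apply/tensor_eq; rewrite reprK. Qed.

Lemma tensor_perm s t : perm_eq s t -> tensor_eqv s t.
Proof.
elim: s t => [|p s IHs] t.
  by rewrite perm_sym => /perm_nilP ->; apply: TensorRefl.
move=> pst; have pt : p \in t by rewrite -(perm_mem pst) mem_head.
case/splitPr: pt pst => t1 t2 pst.
apply: (@TensorTrans _ ((p :: t2) ++ t1)); last exact: TensorCatC.
rewrite -[p :: s]cat1s -[(p :: t2) ++ t1]/([:: p] ++ (t2 ++ t1)).
apply: TensorCat; [exact: TensorRefl | apply: IHs].
by move: pst; rewrite perm_sym perm_catC /= perm_cons perm_sym.
Qed.

Definition seq_opp (s : seq (B * C)) := [seq (- p.1, p.2) | p <- s].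
Definition seq_mul (s t : seq (B * C)) :=
  [seq (p.1 * q.1, p.2 * q.2) | p <- s, q <- t].

Lemma seq_oppP s t : tensor_eqv s t -> tensor_eqv (seq_opp s) (seq_opp t).
Proof.
elim=> {s t} /=.
- by move=> s; apply: TensorRefl.
- by move=> s t _; apply: TensorSym.
- by move=> s t u _ st _; apply: TensorTrans.
- by move=> s s' t t' _ ss' _ tt'; rewrite /seq_opp !map_cat; apply: TensorCat.
- by move=> s t; rewrite /seq_opp !map_cat; apply: TensorCatC.
- by move=> c; rewrite oppr0; apply: TensorZero.
- by move=> b b' c; rewrite opprD; apply: TensorDl.
- by move=> b c c'; apply: TensorDr.
- by move=> a b c; rewrite -mulrN; apply: TensorBal.
Qed.

Lemma seq_mul_cons p s t :
  seq_mul (p :: s) t = [seq (p.1 * q.1, p.2 * q.2) | q <- t] ++ seq_mul s t.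
Proof. by []. Qed.

Lemma seq_mul_cat s s' t : seq_mul (s ++ s') t = seq_mul s t ++ seq_mul s' t.
Proof. exact: allpairs_cat. Qed.

Lemma seq_mulC s t : perm_eq (seq_mul s t) (seq_mul t s).
Proof.
elim: s => [|p s IHs]; first by rewrite /seq_mul allpairs0r.
rewrite seq_mul_cons perm_sym.
rewrite /seq_mul (perm_allpairs_consr _ _ (fun=> p) (fun=> s)).
rewrite perm_sym perm_cat //.
by under eq_map => q do rewrite mulrC [p.2 * _]mulrC.
Qed.

Lemma seq_mulP s t u : tensor_eqv s t -> tensor_eqv (seq_mul s u) (seq_mul t u).
Proof.
have split1 v : (forall q, tensor_eqv (seq_mul s [:: q]) (seq_mul t [:: q])) ->
    tensor_eqv (seq_mul s v) (seq_mul t v).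
  move=> H; elim: v => [|q v IHv].
    by apply: tensor_perm; rewrite (perm_trans (seq_mulC _ _)) // perm_sym
      (perm_trans (seq_mulC _ _)).
  have E w : tensor_eqv (seq_mul w (q :: v)) (seq_mul w [:: q] ++ seq_mul w v).
    apply: tensor_perm; apply: perm_trans (seq_mulC _ _) _.
    rewrite -cat1s seq_mul_cat; apply: perm_cat; exact: seq_mulC.
  apply: TensorTrans (E s) _; apply: TensorTrans (TensorSym (E t)).
  exact: TensorCat.
move=> st; apply: split1 => -[b0 c0]; elim: st => {s t}.
- by move=> s; apply: TensorRefl.
- by move=> s t _; apply: TensorSym.
- by move=> s t v _ st _; apply: TensorTrans.
- by move=> s s' t t' _ ss' _ tt'; rewrite !seq_mul_cat; apply: TensorCat.
- by move=> s t; rewrite !seq_mul_cat; apply: TensorCatC.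
- by move=> c; rewrite /seq_mul /= mul0r; apply: TensorZero.
- by move=> b b' c; rewrite /seq_mul /= mulrDl; apply: TensorDl.
- by move=> b c c'; rewrite /seq_mul /= mulrDl; apply: TensorDr.
- by move=> a b c; rewrite /seq_mul /= -!mulrA; apply: TensorBal.
Qed.

Lemma seq_mulP2 s s' t t' : tensor_eqv s s' -> tensor_eqv t t' ->
  tensor_eqv (seq_mul s t) (seq_mul s' t').
Proof.
move=> ss' tt'; apply: TensorTrans (seq_mulP t ss') _.
apply: TensorTrans (tensor_perm (seq_mulC _ _)) _.
apply: TensorTrans (seq_mulP s' tt') _.
exact/tensor_perm/seq_mulC.
Qed.

Definition tensor_zero : tensor := \pi_tensor [::].
Definition tensor_opp (x : tensor) : tensor := \pi_tensor (seq_opp (repr x)).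
Definition tensor_add (x y : tensor) : tensor := \pi_tensor (repr x ++ repr y).
Definition tensor_one : tensor := \pi_tensor [:: (1, 1)].
Definition tensor_mul (x y : tensor) : tensor :=
  \pi_tensor (seq_mul (repr x) (repr y)).

Lemma tensor_piN s : tensor_opp (\pi_tensor s) = \pi_tensor (seq_opp s).
Proof. exact/tensor_eq/seq_oppP/tensor_repr. Qed.
Lemma tensor_piD s t :
  tensor_add (\pi_tensor s) (\pi_tensor t) = \pi_tensor (s ++ t).
Proof. by apply/tensor_eq/TensorCat; apply: tensor_repr. Qed.
Lemma tensor_piM s t :
  tensor_mul (\pi_tensor s) (\pi_tensor t) = \pi_tensor (seq_mul s t).
Proof. by apply/tensor_eq/seq_mulP2; apply: tensor_repr. Qed.

Lemma tensor_addA : associative tensor_add.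
Proof.
move=> x y z; have [s ->] := tensor_surj x; have [t ->] := tensor_surj y.
by have [u ->] := tensor_surj z; rewrite !tensor_piD catA.
Qed.
Lemma tensor_addC : commutative tensor_add.
Proof.
move=> x y; have [s ->] := tensor_surj x; have [t ->] := tensor_surj y.
by rewrite !tensor_piD; apply/tensor_eq/TensorCatC.
Qed.
Lemma tensor_add0 : left_id tensor_zero tensor_add.
Proof. by move=> x; have [s ->] := tensor_surj x; rewrite tensor_piD. Qed.
Lemma tensor_addN : left_inverse tensor_zero tensor_opp tensor_add.
Proof.
move=> x; have [s ->] := tensor_surj x; rewrite tensor_piN tensor_piD.
apply/tensor_eq; elim: s => [|[b c] s IHs]; first exact: TensorRefl.
apply: (@TensorTrans _ ([:: (- b, c); (b, c)] ++ (seq_opp s ++ s))).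
  apply: tensor_perm; rewrite /= perm_cons.
  by rewrite -[(b, c) :: s]cat1s -[X in perm_eq _ X]cat1s perm_catCA.
apply: (@TensorTrans _ ([::] ++ [::])); last exact: TensorRefl.
apply: TensorCat => //; apply: TensorTrans (TensorSym (TensorDl _ _ _)) _.
by rewrite addNr; apply: TensorZero.
Qed.
HB.instance Definition _ := GRing.isZmodule.Build tensor
  tensor_addA tensor_addC tensor_add0 tensor_addN.

Lemma tensor_piDr s t :
  \pi_tensor s + \pi_tensor t = \pi_tensor (s ++ t) :> tensor.
Proof. exact: tensor_piD. Qed.
Lemma tensor_mulC : commutative tensor_mul.
Proof.
move=> x y; have [s ->] := tensor_surj x; have [t ->] := tensor_surj y.
by rewrite !tensor_piM; apply/tensor_eq/tensor_perm/seq_mulC.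
Qed.
Lemma tensor_mulD : left_distributive tensor_mul +%R.
Proof.
move=> x y z; have [s ->] := tensor_surj x; have [t ->] := tensor_surj y.
have [u ->] := tensor_surj z.
by rewrite tensor_piDr !tensor_piM tensor_piDr seq_mul_cat.
Qed.
Lemma tensor_mul1 : left_id tensor_one tensor_mul.
Proof.
move=> x; have [s ->] := tensor_surj x; rewrite tensor_piM.
congr (\pi_tensor _); rewrite seq_mul_cons cats0 /=.
by elim: s => //= -[b c] s ->; rewrite !mul1r.
Qed.
Lemma seq_mulA s t u : seq_mul s (seq_mul t u) = seq_mul (seq_mul s t) u.
Proof.
elim: s => // p s IHs; rewrite !seq_mul_cons seq_mul_cat -IHs; congr (_ ++ _).
elim: t {IHs} => // q t IHt.
rewrite /= seq_mul_cons [in RHS]seq_mul_cons map_cat IHt.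
by congr (_ ++ _); rewrite -map_comp; apply: eq_map => r /=; rewrite !mulrA.
Qed.
Lemma tensor_mulA : associative tensor_mul.
Proof.
move=> x y z; have [s ->] := tensor_surj x; have [t ->] := tensor_surj y.
by have [u ->] := tensor_surj z; rewrite !tensor_piM seq_mulA.
Qed.
HB.instance Definition _ := GRing.Zmodule_isComPzRing.Build tensor
  tensor_mulA tensor_mulC tensor_mul1 tensor_mulD.
Lemma tensor_piMr s t :
  \pi_tensor s * \pi_tensor t = \pi_tensor (seq_mul s t) :> tensor.
Proof. exact: tensor_piM. Qed.

End Tensor.

(* The multiplication map B (x)_A B -> B. *)
Section MultiplicationMap.
Variables (A B : comPzRingType) (f : {rmorphism A -> B}).

Definition seq_sum (s : seq (B * B)) : B := \sum_(p <- s) p.1 * p.2.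
Definition mult_map (x : tensor f f) : B := seq_sum (repr x).

Lemma seq_sumP s t : tensor_eqv f f s t -> seq_sum s = seq_sum t.
Proof.
rewrite /seq_sum; elim=> {s t} //.
- by move=> s t u _ -> _ ->.
- by move=> s s' t t' _ ss' _ tt'; rewrite !big_cat /= ss' tt'.
- by move=> s t; rewrite !big_cat /= addrC.
- by move=> c; rewrite big_seq1 big_nil mul0r.
- by move=> b b' c; rewrite !big_cons !big_nil /= !addr0 mulrDl.
- by move=> b c c'; rewrite !big_cons !big_nil /= !addr0 mulrDr.
- by move=> a b c; rewrite !big_seq1 /= mulrA [b * _]mulrC.
Qed.

Lemma mult_mapE s : mult_map (\pi_(tensor f f) s) = seq_sum s.
Proof. exact/seq_sumP/tensor_repr. Qed.

Lemma mult_map_nmod : nmod_morphism mult_map.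
Proof.
split; first by rewrite -[0]/(tensor_zero f f) mult_mapE /seq_sum big_nil.
move=> x y; have [s ->] := tensor_surj x; have [t ->] := tensor_surj y.
by rewrite tensor_piDr !mult_mapE /seq_sum big_cat.
Qed.
Lemma mult_map_monoid : monoid_morphism mult_map.
Proof.
split; first by rewrite -[1]/(tensor_one f f) mult_mapE /seq_sum big_seq1 mulr1.
move=> x y; have [s ->] := tensor_surj x; have [t ->] := tensor_surj y.
rewrite tensor_piMr !mult_mapE.
rewrite /seq_sum /seq_mul big_allpairs_dep mulr_suml; apply: eq_bigr => p _.
by rewrite mulr_sumr; apply: eq_bigr => q _; rewrite mulrACA.
Qed.
HB.instance Definition _ := GRing.isNmodMorphism.Build
  (tensor f f) B mult_map mult_map_nmod.
HB.instance Definition _ := GRing.isMonoidMorphism.Build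
  (tensor f f) B mult_map mult_map_monoid.

End MultiplicationMap.
Arguments mult_map {A B} f x.

Definition separable_algebra (A B : comPzRingType) (f : {rmorphism A -> B}) :
    Prop :=
  projective (restrict (mult_map f)).

Definition finite_etale (A B : comPzRingType) (f : {rmorphism A -> B}) : Prop :=
  projective (restrict f) /\ separable_algebra f.

(* Main.v *)
(** Let [p] be a nonzero prime of [Z] with local uniformizer [pi], and let [pi^e]
    generate [a] locally at [p]; it suffices to show that [m] divides every [e],
    for then [a = b^m] with [b = {z | z^m in a}], as one checks locally. If [e > 0],
    choose a maximal ideal [q] of [R] containing [p] and [I]. As [R/I] is étale over
    [Z/a], locally at [q] the ideal [q] is generated by [pi] and [I], and the chain
    of the [pi^i R + I] shows that [R/I] has length [e] at [q]. Multiplication by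
    the invertible ideal [I] carries [S/R] to [SI/I], and [S/R] has finite length
    because it is killed by a nonzero element of [Z]; so [S/SI = S/b^m] also has
    length [e] over [R] at [q]. Finally [b] is invertible over [S], so all the
    [b^i/b^(i+1)] have the same length, and [m] divides [e].

    All modules are subsets of a ring, and localization at [q] is replaced by
    inclusions up to multiplication by an element outside [q]. *)

From HB Require Import structures.
Require Import Defs.
From mathcomp Require Import all_boot all_order all_algebra.
From mathcomp Require Import boolp classical_sets.
From mathcomp Require Import ring zify.

Set Implicit Arguments.
Unset Strict Implicit.
Unset Printing Implicit Defensive.

Import GRing.Theory.
Local Open Scope classical_set_scope.
Local Open Scope ring_scope.

(** * Submodules of a ring *)

(** Since [R] need not be integrally closed, its maximal ideals carry no valuation, and length takes
    over that role. It is counted over [R] at a single [q]: over [Z] at [p] residue degrees would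
    enter as factors, and [m] would only be seen to divide a multiple of [e]. The two halves of
    finite-étale give the two bounds for [R/I]: by separability each layer of the chain of the
    [pi^i R + I] has length at most 1, and by projectivity no layer with [i < e] vanishes. The
    obstacle is that the ideal of [S] is invertible over [S], while lengths are taken over [R].
    Classically [S] localized at [q] is semilocal and the ideal becomes principal; here a filtration
    with locally [S]-simple layers replaces the choice of a generator. For [m = 0] no length is
    involved: as [S] is finite over [R], the equality [SI = S] forces [I = R]. *)

Section Sets.
Variable Q : comNzRingType.
Implicit Types (A M N P X Y T : set Q) (n i j l : nat).

Definition subring A :=
  [/\ A 1, forall x y, A x -> A y -> A (x - y) & forall x y, A x -> A y -> A (x * y)].

Definition submod A N :=
  [/\ N 0, forall x y, N x -> N y -> N (x + y) & forall a x, A a -> N x -> N (a * x)].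

Definition mulset T := T 1 /\ forall x y, T x -> T y -> T (x * y).

Lemma subring0 A : subring A -> A 0.
Proof. by case=> A1 AB _; rewrite -(subrr (1 : Q)); apply: AB. Qed.

Lemma subringN A x : subring A -> A x -> A (- x).
Proof. by move=> hA Ax; rewrite -sub0r; case: (hA) => _ AB _; apply: AB => //; apply: subring0.
Qed.

Lemma subringD A x y : subring A -> A x -> A y -> A (x + y).
Proof.
by move=> hA Ax Ay; rewrite -[y]opprK; case: (hA) => _ AB _; apply: AB => //; apply: subringN.
Qed.

Lemma subring_submod A : subring A -> submod A A.
Proof.
by move=> hA; split=> [|x y|]; [exact: subring0|exact: subringD|case: hA].
Qed.

Lemma submodN A N x : subring A -> submod A N -> N x -> N (- x).
Proof.
by move=> hA [_ _ NM] Nx; rewrite -mulN1r; apply: NM => //; apply: subringN => //; case: hA.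
Qed.

Lemma submodB A N x y : subring A -> submod A N -> N x -> N y -> N (x - y).
Proof. by move=> hA hN Nx Ny; case: (hN) => _ ND _; apply: ND => //; apply: submodN hA hN _. Qed.

Lemma submod_sub A A' N : A `<=` A' -> submod A' N -> submod A N.
Proof. by move=> AA [N0 ND NM]; split=> // a x /AA; apply: NM. Qed.

Lemma submodI A N P : submod A N -> submod A P -> submod A (N `&` P).
Proof.
move=> [N0 ND NM] [P0 PD PM]; split=> // [x y [Nx Px] [Ny Py]|a x Aa [Nx Px]].
  by split; [apply: ND|apply: PD].
by split; [apply: NM|apply: PM].
Qed.

Definition addset N P : set Q := [set z | exists x y, [/\ N x, P y & z = x + y]].

Lemma submod_addset A N P : submod A N -> submod A P -> submod A (addset N P).
Proof.
move=> [N0 ND NM] [P0 PD PM]; split=> [|_ _ [x [y [Nx Py ->]]] [x' [y' [Nx' Py' ->]]]|].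
- by exists 0, 0; rewrite addr0.
- by exists (x + x'), (y + y'); rewrite addrACA; split; [apply: ND|apply: PD|].
- move=> a _ Aa [x [y [Nx Py ->]]].
  by exists (a * x), (a * y); rewrite mulrDr; split; [apply: NM|apply: PM|].
Qed.

Lemma subset_addl N P : P 0 -> N `<=` addset N P.
Proof. by move=> P0 x Nx; exists x, 0; rewrite addr0. Qed.

Lemma subset_addr N P : N 0 -> P `<=` addset N P.
Proof. by move=> P0 x Nx; exists 0, x; rewrite add0r. Qed.

Lemma addset_min A N P M :
  submod A M -> N `<=` M -> P `<=` M -> addset N P `<=` M.
Proof. by move=> [_ MD _] NM PM _ [x [y [/NM Nx /PM Py ->]]]; apply: MD. Qed.

Definition scaleset X (g : Q) : set Q := [set x * g | x in X].

Lemma submod_scaleset A X g : submod A X -> submod A (scaleset X g).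
Proof.
move=> [X0 XD XM]; split=> [|_ _ [x Xx <-] [y Xy <-]|a _ Aa [x Xx <-]].
- by exists 0; rewrite ?mul0r.
- by exists (x + y); [apply: XD|rewrite mulrDl].
- by exists (a * x); [apply: XM|rewrite mulrA].
Qed.

(** The conductor [(N : g)] in [A], that is, the kernel of [a |-> a * g] from [A] to
    [(N + A g) / N]; it reduces cyclic quotients to quotients of [A]. *)
Definition coloset A N (g : Q) : set Q := [set s | A s /\ N (s * g)].

Lemma submod_coloset A A' N g : A' `<=` A -> subring A -> submod A' N ->
  submod A' (coloset A N g).
Proof.
move=> AA [A1 AB AM] [N0 ND NM]; split=> [|x y [Ax Nx] [Ay Ny]|a x Aa [Ax Nx]].
- by split; [rewrite -(subrr (1 : Q)); apply: AB|rewrite mul0r].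
- split; last by rewrite mulrDl; apply: ND.
  by apply: subringD => //; split.
- by split; [apply: AM => //; apply: AA|rewrite -mulrA; apply: NM].
Qed.

(** Sums carry no coefficients: a factor that is a submodule absorbs the scalars. *)
Inductive prodset X Y : set Q :=
| Prodset0 : prodset X Y 0
| ProdsetD x y z : X x -> Y y -> prodset X Y z -> prodset X Y (x * y + z).

Lemma prodset_mul X Y x y : X x -> Y y -> prodset X Y (x * y).
Proof. by move=> Xx Yy; rewrite -[_ * _]addr0; apply/ProdsetD/Prodset0. Qed.

Lemma prodsetD X Y x y : prodset X Y x -> prodset X Y y -> prodset X Y (x + y).
Proof.
by move=> + XYy; elim=> [|a b z Xa Yb _ IH]; rewrite ?add0r // -addrA; apply: ProdsetD.
Qed.

Lemma prodset_ind' X Y M : M 0 -> (forall x y, M x -> M y -> M (x + y)) ->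
  (forall x y, X x -> Y y -> M (x * y)) -> prodset X Y `<=` M.
Proof. by move=> M0 MD MM z; elim=> // x y t Xx Yy _; apply/MD/MM. Qed.

Lemma prodsetS X Y X' Y' : X `<=` X' -> Y `<=` Y' -> prodset X Y `<=` prodset X' Y'.
Proof.
move=> XX YY; apply: prodset_ind' => [|x y|x y /XX Xx /YY Yy].
- exact: Prodset0.
- exact: prodsetD.
- exact: prodset_mul.
Qed.

Lemma prodsetC X Y : prodset X Y = prodset Y X.
Proof.
suff H X' Y' : prodset X' Y' `<=` prodset Y' X' by apply/seteqP.
apply: prodset_ind' => [|x y|x y Xx Yy].
- exact: Prodset0.
- exact: prodsetD.
- by rewrite mulrC; apply: prodset_mul.
Qed.

Lemma prodsetA X Y M : prodset X (prodset Y M) = prodset (prodset X Y) M.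
Proof.
apply/seteqP; split.
  apply: prodset_ind' => [|x y|x y Xx]; [exact: Prodset0|exact: prodsetD|].
  elim=> [|a b z Ya Mb _ IH]; first by rewrite mulr0; apply: Prodset0.
  by rewrite mulrDr mulrA; apply: ProdsetD => //; apply: prodset_mul.
apply: prodset_ind' => [|x y|x y + My]; [exact: Prodset0|exact: prodsetD|].
elim=> [|a b z Xa Yb _ IH]; first by rewrite mul0r; apply: Prodset0.
by rewrite mulrDl -mulrA; apply: ProdsetD => //; apply: prodset_mul.
Qed.

Lemma submod_prodset A X Y : submod A Y -> submod A (prodset X Y).
Proof.
move=> [Y0 YD YM]; split; [exact: Prodset0|exact: prodsetD|].
move=> a x Aa; elim=> [|s t z Xs Yt _ IH]; first by rewrite mulr0; apply: Prodset0.
by rewrite mulrDr mulrCA; apply: ProdsetD => //; apply: YM.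
Qed.

Lemma prodset_id A N : subring A -> submod A N -> prodset A N = N.
Proof.
move=> hA [N0 ND NM]; apply/seteqP; split; first exact: prodset_ind'.
by move=> x Nx; rewrite -[x]mul1r; apply: prodset_mul => //; case: hA.
Qed.

End Sets.

(** * Localized length *)

Section Chains.
Variable Q : comNzRingType.
Variables A T : set Q.
Implicit Types (M N P X Y : set Q) (n i j l : nat).

(* The localization [T^-1 M] is contained in [T^-1 N]. *)
Definition lsub T M N := forall x, M x -> exists2 s, T s & N (s * x).

(* Only the steps that remain strict after inverting [T] are counted; the
   inclusions at the two ends need not be equalities. *)
Inductive chain : set Q -> set Q -> nat -> Prop :=
| Chain0 N M : N `<=` M -> chain N M 0
| ChainS N N' M n : N `<=` N' -> submod A N' -> ~ lsub T N' N -> chain N' M n ->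
    chain N M n.+1.

Lemma chain_sub N M n : chain N M n -> N `<=` M.
Proof.
by elim=> // {}N N' {}M {}n NN _ _ _ NM; apply: subset_trans NM.
Qed.

Lemma chain_subr N M M' n : M `<=` M' -> chain N M n -> chain N M' n.
Proof.
move=> MM; elim: n N => [|n IH] N.
  by move=> /chain_sub NM; apply/Chain0/(subset_trans NM).
move=> H; inversion H as [|N1 N' M1 n1 NN hN' st c]; subst.
by apply: ChainS (IH _ c).
Qed.

Lemma lsubS M M' N N' : M `<=` M' -> N `<=` N' -> lsub T M' N -> lsub T M N'.
Proof. by move=> MM NN h x /MM/h[s Ts Nx]; exists s => //; apply: NN. Qed.

Lemma chain_subl N N' M n : N `<=` N' -> chain N' M n -> chain N M n.
Proof.
move=> NN; case: n => [|n] H.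
  by exact: Chain0 (subset_trans NN (chain_sub H)).
inversion H as [|N1 N2 M1 n1 N12 hN' st c]; subst.
apply: ChainS c => //; first exact: subset_trans N12.
by apply: contra_not st; apply: lsubS.
Qed.

Lemma chain_cat N P M i j : chain N P i -> chain P M j -> chain N M (i + j).
Proof.
move=> + c; elim: i N => [|i IH] N.
  by move=> /chain_sub NP; apply: chain_subl c.
move=> H; inversion H as [|N1 N' M1 n1 NN hN' st c']; subst.
by rewrite addSn; apply: ChainS (IH _ c').
Qed.

Hypotheses (hA : subring A) (TA : T `<=` A) (hT : mulset T).

Lemma lsub_refl N : lsub T N N.
Proof. by move=> x Nx; exists 1; rewrite ?mul1r //; case: hT. Qed.

(* The modular law: this makes [len_le] additive. *)
Lemma modular_lsub N N' P : submod A N -> submod A N' -> submod A P -> N `<=` N' ->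
  lsub T (N' `&` P) (N `&` P) -> lsub T (addset N' P) (addset N P) ->
  lsub T N' N.
Proof.
move=> hN hN' hP NN hI hD y N'y.
have [s Ts [n [p [Nn Pp e]]]] : exists2 s, T s & addset N P (s * y).
  by apply: hD; apply: subset_addl => //; case: hP.
have [t Tt [Nt _]] : exists2 t, T t & (N `&` P) (t * p).
  apply: hI; split=> //; have -> : p = s * y - n by rewrite e addrC addKr.
  apply: (submodB hA hN'); last exact: NN.
  by case: hN' => _ _; apply => //; apply: TA.
exists (t * s); first by case: hT => _; apply.
rewrite -mulrA e mulrDr; case: (hN) => _ ND NM; apply: ND => //.
by apply: NM => //; apply: TA.
Qed.

(** The chain is intersected with [P] and added to [P]. By the modular law a strict step stays
    strict on at least one side, possibly on both, whence the inequality. *)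
Lemma chain_split N M P n : submod A N -> submod A P -> chain N M n ->
  exists i j, [/\ (n <= i + j)%N, chain (N `&` P) (M `&` P) i
    & chain (addset N P) (addset M P) j].
Proof.
have addS X Y : X `<=` Y -> addset X P `<=` addset Y P.
  by move=> XY _ [x [y [/XY Yx Py ->]]]; exists x, y.
move=> hN hP c; elim: c hN => {N M n} [N M NM hN|N N' M n NN hN' st _ IH hN].
  by exists 0%N, 0%N; split=> //; apply: Chain0; [apply: setSI|apply: addS].
have [i [j [nij ci cj]]] := IH hN'.
have [h1|h1] := pselect (lsub T (N' `&` P) (N `&` P)).
  have [h2|h2] := pselect (lsub T (addset N' P) (addset N P)).
    by case: st; apply: modular_lsub h1 h2.
  exists i, j.+1; split; first by rewrite addnS ltnS.
    by apply: chain_subl ci; apply: setSI.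
  by apply: ChainS cj => //; [apply: addS|apply: submod_addset].
exists i.+1, j; split; first by rewrite addSn ltnS.
  by apply: ChainS ci => //; [apply: setSI|apply: submodI].
by apply: chain_subl cj; apply: addS.
Qed.

Lemma chain_between N P M n : submod A N -> submod A P -> submod A M ->
  N `<=` P -> P `<=` M -> chain N M n ->
  exists i j, [/\ (n <= i + j)%N, chain N P i & chain P M j].
Proof.
move=> hN hP hM NP PM /(chain_split hN hP)[i [j [nij ci cj]]].
exists i, j; split=> //.
  apply: chain_subl (chain_subr (@subIsetr _ M P) ci).
  by move=> x Nx; split=> //; apply: NP.
apply: chain_subl (chain_subr (addset_min hM (@subset_refl _ M) PM) cj).
by apply: subset_addr; case: hN.
Qed.

(** Length is a supremum of chain lengths, so that uniqueness is immediate and additivity rests on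
    the modular law. *)
Definition len_le N M l := forall n, chain N M n -> (n <= l)%N.
Definition len_is N M l := chain N M l /\ len_le N M l.

Lemma len_is_exists N M l : N `<=` M -> len_le N M l -> exists k, len_is N M k.
Proof.
move=> NM le.
have ex : exists n, (fun n => `[< chain N M n >]) n by exists 0%N; apply/asboolP/Chain0.
have ub n : `[< chain N M n >] -> (n <= l)%N by move=> /asboolP/le.
case: (ex_maxnP ex ub) => k /asboolP ck mk; exists k; split=> // n cn.
exact/mk/asboolP.
Qed.

Lemma len_is_uniq N M l l' : len_is N M l -> len_is N M l' -> l = l'.
Proof. by move=> [c le] [c' le']; apply/eqP; rewrite eqn_leq le' // le. Qed.

Section Between.
Variables (N P M : set Q).
Hypotheses (hN : submod A N) (hP : submod A P) (hM : submod A M)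
  (NP : N `<=` P) (PM : P `<=` M).

Lemma len_le_add i j : len_le N P i -> len_le P M j -> len_le N M (i + j).
Proof.
move=> li lj n /(chain_between hN hP hM NP PM)[i' [j' [le /li ii /lj jj]]].
exact: leq_trans le (leq_add ii jj).
Qed.

Lemma len_is_add i j : len_is N P i -> len_is P M j -> len_is N M (i + j).
Proof.
by move=> [ci li] [cj lj]; split; [apply: chain_cat cj|apply: len_le_add].
Qed.

Lemma len_is_between l : len_is N M l ->
  exists i j, [/\ len_is N P i, len_is P M j & l = (i + j)%N].
Proof.
move=> hl; have [_ le] := hl.
have [i li] : exists i, len_is N P i.
  by apply: (@len_is_exists _ _ l) => // n c; apply: le; apply: chain_subr c.
have [j lj] : exists j, len_is P M j.
  by apply: (@len_is_exists _ _ l) => // n c; apply: le; apply: chain_subl c.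
by exists i, j; split=> //; apply: len_is_uniq (len_is_add li lj).
Qed.

End Between.

Lemma len_is0 N M : N `<=` M -> lsub T M N -> len_is N M 0.
Proof.
move=> NM MN; split; first exact: Chain0.
move=> [|n] // c; inversion c as [|N1 N' M1 n1 NN hN' st c']; subst.
by case: st; apply: lsubS MN => //; apply: chain_sub c'.
Qed.

Lemma len_is0_lsub N M : N `<=` M -> submod A M -> len_is N M 0 -> lsub T M N.
Proof.
move=> NM hM [_ le]; apply: contrapT => st.
by have := le 1%N (ChainS NM hM st (Chain0 (@subset_refl _ M))).
Qed.

(** Reflecting localized inclusions keeps the steps strict. It is asked only between [N0] and [M0],
    where the conductor and sum correspondences have this property. *)
Lemma chain_map (phi : set Q -> set Q) N0 M0 n :
  submod A N0 ->
  (forall X Y, X `<=` Y -> phi X `<=` phi Y) ->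
  (forall X, submod A X -> submod A (phi X)) ->
  (forall X Y, submod A X -> submod A Y -> N0 `<=` X -> X `<=` Y -> Y `<=` M0 ->
     lsub T (phi Y) (phi X) -> lsub T Y X) ->
  chain N0 M0 n -> chain (phi N0) (phi M0) n.
Proof.
move=> hN0 phiS phiM phiL.
suff H N : submod A N -> N0 `<=` N -> chain N M0 n -> chain (phi N) (phi M0) n by exact: H.
elim: n N => [|n IH] N hN N0N c.
  exact: Chain0 (phiS _ _ (chain_sub c)).
inversion c as [|N1 N' M1 n1 NN hN' st c']; subst.
apply: ChainS (IH N' hN' (subset_trans N0N NN) c'); [exact: phiS|exact: phiM|].
by move=> h; apply: st; apply: phiL h => //; apply: chain_sub c'.
Qed.

Lemma len_is_map (phi : set Q -> set Q) N M l :
  (forall n, chain N M n -> chain (phi N) (phi M) n) ->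
  (forall n, chain (phi N) (phi M) n -> chain N M n) ->
  len_is N M l -> len_is (phi N) (phi M) l.
Proof. by move=> h h' [c le]; split; [apply: h|move=> n /h'/le]. Qed.

(** An element of a product is a finite sum, and the denominators of its terms multiply to a common
    one. *)
Lemma lsub_prodset X M N : submod A N -> lsub T M N ->
  lsub T (prodset X M) (prodset X N).
Proof.
move=> hN MN _ [|x0 y0 z0 Xx0 My0 Pz0].
  by exists 1; [case: hT|rewrite mulr0; apply: Prodset0].
have : prodset X M (x0 * y0 + z0) by apply: ProdsetD.
elim=> {x0 y0 z0 Xx0 My0 Pz0} [|x y z Xx /MN[t Tt Nt] _ [s Ts Ns]].
  by exists 1; [case: hT|rewrite mulr0; apply: Prodset0].
exists (s * t); first by case: hT => _; apply.
have -> : s * t * (x * y + z) = x * (s * (t * y)) + t * (s * z) by ring.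
have [_ PD PM] := submod_prodset X hN.
apply: PD; last by apply: PM => //; apply: TA.
by apply: prodset_mul => //; case: hN => _ _; apply => //; apply: TA.
Qed.


Lemma chain_prodset I J N M n : prodset J I = A -> submod A N -> submod A M ->
  chain N M n -> chain (prodset I N) (prodset I M) n.
Proof.
move=> JI hN hM; apply: chain_map => //.
- by move=> P1 P2; apply: prodsetS.
- by move=> P1; apply: submod_prodset.
- move=> P1 P2 h1 h2 _ _ _ /(lsub_prodset (X := J) (submod_prodset I h1)).
  by rewrite !prodsetA JI !prodset_id.
Qed.

(* Multiplication by [J] is inverse to multiplication by [I] on submodules. *)
Lemma len_is_prodset I J N M l : prodset I J = A -> submod A N -> submod A M ->
  len_is N M l -> len_is (prodset I N) (prodset I M) l.
Proof.
move=> IJ hN hM; apply: (len_is_map (phi := prodset I)) => n.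
  by apply: (chain_prodset (J := J)) => //; rewrite prodsetC.
move=> /(chain_prodset IJ (submod_prodset I hN) (submod_prodset I hM)).
by rewrite !prodsetA [prodset J I]prodsetC IJ !prodset_id.
Qed.

End Chains.

(** [Zorn_bigcup] also demands the union of the empty chain, so it is applied to [P] enlarged by
    [set0]; the member [X0] covers the case where [set0] comes out maximal. *)
Lemma Zorn_bigcup_nonempty (U : Type) (P : set (set U)) X0 : P X0 ->
  (forall F X, F X -> F `<=` P -> total_on F subset -> P (\bigcup_(Y in F) Y)) ->
  exists2 M, P M & forall N, P N -> M `<=` N -> N `<=` M.
Proof.
move=> PX0 Pcup; have [F FP totF|M [[M0|PM] Mmax]] := @Zorn_bigcup _ [set X | X = set0 \/ P X].
- have [[X [FX PX]]|noX] := pselect (exists X, (F `&` P) X); last first.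
    left; apply/seteqP; split=> // x [X FX Xx]; case: (FP X FX) => [X0'|PX].
      by rewrite X0' in Xx.
    by case: noX; exists X.
  right; suff -> : \bigcup_(Y in F) Y = \bigcup_(Y in F `&` P) Y.
    by apply: (Pcup _ X) => [//|Y []|Y Z [FY _] [FZ _]] //; apply: totF.
  apply/seteqP; split=> x [Y]; last by case=> FY _ Yx; exists Y.
  by move=> FY Yx; exists Y => //; split=> //; case: (FP Y FY) => // Y0; rewrite Y0 in Yx.
- exists X0 => // N PN X0N x Nx; exfalso; apply: (Mmax N); last by right.
  by rewrite M0; split=> // /(_ x Nx).
exists M => // N PN MN; apply: contrapT => NM.
by apply: (Mmax N); [split|right].
Qed.

Section MaximalSubmodule.
Variable Q : comNzRingType.
Implicit Types (A K M U : set Q).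

(** With [U = [set 1]] and [A] the whole ring these are the maximal ideals; with [A = S] and [U] the
    union of [T] and the complement of [S], those of the localization of [S] at [T]. *)
Definition maximal_avoiding A U M :=
  [/\ submod A M, forall x, M x -> ~ U x
    & forall M', submod A M' -> M `<=` M' -> (forall x, M' x -> ~ U x) -> M' `<=` M].

Lemma maximal_avoiding_exists A U K : submod A K -> (forall x, K x -> ~ U x) ->
  exists2 M, K `<=` M & maximal_avoiding A U M.
Proof.
move=> hK KU.
pose P := [set X | [/\ submod A X, K `<=` X & forall x, X x -> ~ U x]].
have [||M [hM KM MU] Mmax] := @Zorn_bigcup_nonempty _ P K; first by split.
  move=> F X FX FP totF.
  split=> [|x Kx|x [Y /FP[_ _ YU] Yx]]; last exact: YU.
    split=> [|x y [Y FY Yy] [Z FZ Zy]|a x Aa [Y FY Yx]].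
    - by exists X => //; case: (FP X FX) => -[].
    - have [YZ|ZY] := totF Y Z FY FZ.
        by exists Z => //; case: (FP Z FZ) => -[_ ZD _] _ _; apply: ZD => //; apply: YZ.
      by exists Y => //; case: (FP Y FY) => -[_ YD _] _ _; apply: YD => //; apply: ZY.
    - by exists Y => //; case: (FP Y FY) => -[_ _ YM] _ _; apply: YM.
  by exists X => //; case: (FP X FX) => _ + _; apply.
exists M => //; split=> // M' hM' MM M'U; apply: Mmax => //; split=> //.
exact: subset_trans MM.
Qed.

End MaximalSubmodule.

(** * Invariance of length under an invertible ideal of an overring *)

Section Invariance.
Variable Q : comNzRingType.
Variables A S T B B' : set Q.
Hypotheses (hA : subring A) (hS : subring S) (AS : A `<=` S) (TA : T `<=` A)
  (hT : mulset T) (BB : prodset B B' = S).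
Implicit Types (N M K : set Q).

Let submodA N : submod S N -> submod A N.
Proof. exact: submod_sub. Qed.

(** Multiplication by [g] identifies [S / (N : g)] with [(N + S g) / N]; on submodules the two
    directions are [Y |-> (Y : g)] and [X |-> N + X g]. *)
Lemma chain_coloset N g n : submod S N ->
  chain A T N (addset N (scaleset S g)) n <-> chain A T (coloset S N g) S n.
Proof.
move=> hN; have hNA := submodA hN; split.
  move=> c; apply: (@chain_subr _ _ _ _ (coloset S (addset N (scaleset S g)) g)).
    by move=> s [].
  apply: (chain_map (phi := fun Y => coloset S Y g)) c => //.
  - by move=> X Y XY s [Ss Xs]; split=> //; apply: XY.
  - by move=> X hX; apply: submod_coloset.
  - move=> X Y hX hY NX XY YM h _ /[dup] /YM[n0 [_ [Nn0 [s Ss <-] ->]]] Yy.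
    have [|t Tt [_ Xt]] := h s.
      split=> //; have -> : s * g = n0 + s * g - n0 by ring.
      by apply: (submodB hA hY) => //; apply/XY/NX.
    exists t => //; rewrite mulrDr; case: hX => _ XD XM; apply: XD; last by rewrite mulrA.
    by apply: XM; [apply: TA|apply: NX].
move=> c; apply: (@chain_subl _ _ _ _ (addset N (scaleset (coloset S N g) g))).
  by apply: subset_addl; exists 0; rewrite ?mul0r //; split;
    [apply: subring0|rewrite mul0r; case: hN].
apply: (chain_map (phi := fun X => addset N (scaleset X g))) c => //.
- exact: submod_coloset.
- by move=> X Y XY _ [x [_ [Nx [s /XY Ys <-] ->]]]; exists x, (s * g); split=> //; exists s.
- by move=> X hX; apply: submod_addset => //; apply: submod_scaleset.
- move=> X Y hX hY NX XY YS h s Ys.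
  have [|t Tt [n0 [_ [Nn0 [x Xx <-] e]]]] := h (s * g).
    by apply: subset_addr; [case: hN|exists s].
  exists t => //; have -> : t * s = (t * s - x) + x by ring.
  case: (hX) => _ XD _; apply: XD => //; apply: NX; split.
    case: hS => _ SB SM; apply: SB; last exact/YS/XY.
    by apply: SM; [apply/AS/TA|apply: YS].
  by have -> : (t * s - x) * g = n0 by ring: e.
Qed.

Lemma len_is_coloset N g l : submod S N ->
  len_is A T N (addset N (scaleset S g)) l <-> len_is A T (coloset S N g) S l.
Proof.
move=> hN; have E n := chain_coloset g n hN.
by split=> -[c le]; split=> [|n c']; apply/E || apply/le/E.
Qed.

(* The case where [M/N] is [S]-simple: both [M/N] and its product with [B] are
   locally isomorphic to [S/K], where [K] is the annihilator of [g] modulo [N]. *)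
Let len_is_prodset_simple N g l : submod S N ->
  maximal_avoiding S (T `|` ~` S) (coloset S N g) ->
  len_is A T N (addset N (scaleset S g)) l ->
  len_is A T (prodset B N) (prodset B (addset N (scaleset S g))) l.
Proof.
move=> hN [hK KT Kmax]; set K := coloset S N g in hK KT Kmax; set M := addset _ _.
have hSS := subring_submod hS; have hM : submod S M by apply/submod_addset/submod_scaleset.
have S1 : S 1 by case: hS.
have Mg : M g by apply: subset_addr; [case: hN|exists 1; rewrite ?mul1r].
have NM : N `<=` M by apply: subset_addl; exists 0; rewrite ?mul0r //; apply: subring0.
have BBN X : submod S X -> prodset B (prodset B' X) = X.
  by move=> hX; rewrite prodsetA BB prodset_id.
have BBN' X : submod S X -> prodset B' (prodset B X) = X.
  by move=> hX; rewrite prodsetA [prodset B' B]prodsetC BB prodset_id.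
have KM : prodset K M `<=` N.
  have [N0 ND NM'] := hN.
  apply: prodset_ind' => // k _ [Sk Nkg] [n [_ [Nn [s Ss <-] ->]]].
  by rewrite mulrDr mulrCA; apply: ND; apply: NM'.
(* If [B M] were locally inside [B N], multiplying by the inverse [B'] would put [g] locally into
   [N]. *)
have [h BMh hBN] : exists2 h, prodset B M h & forall t, T t -> ~ prodset B N (t * h).
  apply: contrapT => no; have [t Tt Nt] : exists2 t, T t & N (t * g).
    rewrite -{1}(BBN' _ hM) in Mg; rewrite -(BBN' _ hN).
    apply: (lsub_prodset (A := A)) Mg => //; first exact/submodA/submod_prodset.
    move=> h BMh; apply: contrapT => no'; apply: no; exists h => // t Tt BNt.
    by apply: no'; exists t.
  by apply: (KT t); [split=> //; apply/AS/TA|left].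
have hBN' : submod S (prodset B N) by apply: submod_prodset.
have avoid L : submod S L -> K `<=` L -> L `<=` S -> (forall t, T t -> ~ L t) -> L = K.
  move=> hL KL LS LT; apply/seteqP; split=> //; apply: Kmax => // x Lx [Tx|]; first exact: LT Lx.
  by apply; apply: LS.
(* This conductor contains [K] because [K M] lies in [N], and misses [T] by the choice of [h];
   maximality of [K] forces equality. *)
have LK : coloset S (prodset B N) h = K.
  apply: avoid => [||x []//|t Tt [_ /hBN]]; [exact: submod_coloset| |exact].
  move=> s Ks; split; first by case: Ks.
  apply: (@prodsetS _ B (prodset K M) B N) => //.
  by rewrite prodsetA [prodset B K]prodsetC -prodsetA; apply: prodset_mul.
set M' := addset (prodset B N) (scaleset S h).
have hM' : submod S M' by apply/submod_addset/submod_scaleset.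
have NM' : prodset B N `<=` M' by apply: subset_addl; exists 0; rewrite ?mul0r //; apply: subring0.
have M'M : M' `<=` prodset B M.
  have hBM : submod S (prodset B M) by apply: submod_prodset.
  apply: (addset_min hBM); first exact: prodsetS.
  by move=> _ [s Ss <-]; case: hBM => _ _; apply.
have NB'M' : N `<=` prodset B' M' by rewrite -{1}(BBN' _ hN); apply: prodsetS.
have B'M'M : prodset B' M' `<=` M by rewrite -(BBN' _ hM); apply: prodsetS.
have hB'M' : submod S (prodset B' M') by apply: submod_prodset.
(* [B' M'] lies between [N] and [M]. If its conductor of [g] misses [T], that conductor is [K], so
   [B' M'] lies in [N] and [M'] in [B N], against the choice of [h]. *)
have MM' : lsub T M (prodset B' M').
  have [t Tt [_ Mt]] : exists2 t, T t & coloset S (prodset B' M') g t.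
    apply: contrapT => no; have LK' : coloset S (prodset B' M') g = K.
      apply: avoid => [||x []//|t Tt Lt]; last by apply: no; exists t.
        exact: submod_coloset.
      by move=> s [Ss Nsg]; split=> //; apply: NB'M'.
    have B'M'N : prodset B' M' `<=` N.
      move=> x /[dup] /B'M'M[n [_ [Nn [s Ss <-] ->]]] Mx.
      have [_ ND _] := hN; apply: ND => //.
      suff : K s by case.
      rewrite -LK'; split=> //; have -> : s * g = n + s * g - n by ring.
      by apply: (submodB hS hB'M') => //; apply: NB'M'.
    apply: (hBN 1); rewrite ?mul1r; first by case: hT.
    apply: (@prodsetS _ B (prodset B' M') B N) => //; rewrite BBN //.
    by apply: subset_addr; [case: hBN'|exists 1; rewrite ?mul1r].
  move=> _ [n [_ [Nn [s Ss <-] ->]]]; exists t => //.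
  have [_ MD MM] := hB'M'; rewrite mulrDr mulrCA; apply: MD; last exact: MM.
  by apply: MM; [apply/AS/TA|apply: NB'M'].
move=> lenM; rewrite -[l]addn0; apply: (@len_is_add _ A T hA TA hT _ M' _) => //.
- exact: submodA.
- exact: submodA.
- exact/submodA/submod_prodset.
- apply/len_is_coloset => //; rewrite LK; exact/len_is_coloset.
- apply: len_is0 => //; rewrite -(BBN _ hM').
  by apply: (lsub_prodset (A := A)) => //; apply: submodA.
Qed.

(* [B] is only invertible over the larger ring [S], so multiplication by [B] is no
   bijection on [A]-submodules, and one reduces to [S]-simple quotients. *)
Lemma len_is_prodset_invertible N M l : submod S N -> submod S M -> N `<=` M ->
  len_is A T N M l -> len_is A T (prodset B N) (prodset B M) l.
Proof.
move: l {-2}l (leqnn l) N M => b; elim: b => [|b IH] l lb N M hN hM NM lenM.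
  move: lb lenM; rewrite leqn0 => /eqP -> lenM.
  apply: len_is0; first exact: prodsetS.
  apply: (lsub_prodset (A := A)) => //; first exact: submodA.
  by apply: len_is0_lsub lenM => //; apply: submodA.
have [MN|] := pselect (lsub T M N).
  have l0 : l = 0%N by apply: len_is_uniq lenM _; apply: len_is0.
  by apply: IH; rewrite ?l0 // -l0.
move=> nMN; have [g Mg gN] : exists2 g, M g & forall t, T t -> ~ N (t * g).
  apply: contrapT => no; apply: nMN => g Mg; apply: contrapT => no'.
  by apply: no; exists g => // t Tt Ntg; apply: no'; exists t.
(* [(N : g)] misses [T] and so lies in a maximal such [K]. The layer [M1 / N1] built from it is a
   copy of [S / K], inserted between [N] and [M]. *)
have [|s [_ Ns] [/gN|]//|K NK Kmax] :=
  @maximal_avoiding_exists _ S (T `|` ~` S) (coloset S N g).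
  exact: submod_coloset.
have [hK KT _] := Kmax.
have S0 : S 0 by apply: subring0.
have K0 : K 0 by case: hK.
have N0 : N 0 by case: hN.
have S1 : S 1 by case: hS.
have KS : K `<=` S by move=> x Kx; apply: contrapT => nS; apply: (KT x) => //; right.
set N1 := addset N (scaleset K g); set M1 := addset N1 (scaleset S g).
have hN1 : submod S N1 by apply/submod_addset/submod_scaleset.
have hM1 : submod S M1 by apply/submod_addset/submod_scaleset/subring_submod.
have NN1 : N `<=` N1 by apply: subset_addl; exists 0; rewrite ?mul0r.
have NM1 : N1 `<=` M1 by apply: subset_addl; exists 0; rewrite ?mul0r.
have MM1 : M1 `<=` M.
  have [_ _ MM] := hM.
  apply: (addset_min hM); first apply: (addset_min hM) => //.
    by move=> _ [s /KS Ss <-]; apply: MM.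
  by move=> _ [s Ss <-]; apply: MM.
have colN1 : coloset S N1 g = K.
  apply/seteqP; split=> [s [Ss [n [_ [Nn [k Kk <-] e]]]]|k Kk].
    have -> : s = (s - k) + k by ring.
    have [_ KD _] := hK; apply: KD => //; apply: NK; split.
      by case: hS => _ SB _; apply: SB => //; apply: KS.
    by rewrite mulrBl e addrK.
  by split; [apply: KS|apply: subset_addr => //; exists k].
have [i [j [leni lenj e]]] := len_is_between hA TA hT (submodA hN) (submodA hM1) (submodA hM)
  (subset_trans NN1 NM1) MM1 lenM.
have [i1 [k [leni1 lenk e']]] := len_is_between hA TA hT (submodA hN) (submodA hN1) (submodA hM1)
  NN1 NM1 leni.
(* The middle layer has positive length, so the induction hypothesis covers the two outer ones. *)
have k0 : (0 < k)%N.
  case: k lenk {e'} => // /(len_is0_lsub NM1 (submodA hM1)) /(_ g) [|t Tt N1t].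
    by apply: subset_addr; [case: hN1|exists 1; rewrite ?mul1r].
  case: (KT t); last by left.
  by rewrite -colN1; split=> //; apply/AS/TA.
have leb : (i1 <= b)%N && (j <= b)%N by lia.
case/andP: leb => i1b jb; rewrite e e'.
apply: (@len_is_add _ A T hA TA hT _ (prodset B M1) _);
  try (by [apply/submodA/submod_prodset|apply: prodsetS => //; apply: subset_trans NM1]);
  last exact: IH.
apply: (@len_is_add _ A T hA TA hT _ (prodset B N1) _);
  try (by [apply/submodA/submod_prodset|apply: prodsetS => //; apply: subset_trans NM1]);
  first exact: IH.
by apply: len_is_prodset_simple; rewrite ?colN1.
Qed.

End Invariance.

(** * Length bounds for cyclic and finitely generated quotients *)

Section Bounds.
Variable Q : comNzRingType.
Variables A T : set Q.
Hypotheses (hA : subring A) (TA : T `<=` A) (hT : mulset T).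
Implicit Types (N M K : set Q).

(** Fewer scalars and fewer denominators keep every chain; thus lengths over [R] at [q] are bounded
    by lengths over [Z] at [p]. *)
Lemma chain_restrict A' T' N M n : A' `<=` A -> T' `<=` T ->
  chain A T N M n -> chain A' T' N M n.
Proof.
move=> AA TT; elim=> {N M n} [N M|N N' M n NN hN' st _ IH]; first exact: Chain0.
apply: ChainS IH => //; first exact: submod_sub hN'.
by apply: contra_not st => h x /h[s /TT Ts Ns]; exists s.
Qed.

(** A step strict over [N] contains an element outside [q], hence in [T]; it is then locally all of
    [A], and no second strict step is left. *)
Lemma len_le_maximal (q N : set Q) : (forall x, A x -> q x \/ T x) ->
  lsub T q N -> len_le A T N A 1.
Proof.
move=> qT qN [|[|n]] // c; exfalso.
inversion c as [|N0 N1 A1 n1 NN1 hN1 st1 c1]; subst.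
inversion c1 as [|N2 N3 A2 n2 NN2 hN2 st2 c2]; subst.
apply: st1 => y N1y; apply: contrapT => no.
have Ay : A y by apply: (chain_sub c1).
have [/qN[t Tt Nt]|Ty] := qT y Ay; first by apply: no; exists t.
apply: st2 => x /(chain_sub c2) Ax; exists y => //; rewrite mulrC.
by case: hN1 => _ _; apply.
Qed.

Lemma len_le_cyclic N K g l : submod A N -> K `<=` coloset A N g ->
  len_le A T K A l -> len_le A T N (addset N (scaleset A g)) l.
Proof.
move=> hN KN le n /(chain_coloset hA hA (@subset_refl _ A) TA g n hN) c.
by apply: le; apply: chain_subl c.
Qed.

Definition genset N (s : seq Q) := foldr (fun g M => addset M (scaleset A g)) N s.

Lemma submod_genset N s : submod A N -> submod A (genset N s).
Proof.
by move=> hN; elim: s => //= g s IH; apply/submod_addset/submod_scaleset/subring_submod.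
Qed.

Lemma subset_genset N s : N `<=` genset N s.
Proof.
elim: s => //= g s IH; apply: (subset_trans IH); apply: subset_addl.
by exists 0; rewrite ?mul0r //; apply: subring0.
Qed.

(** Each generator adds a cyclic layer that is a quotient of [A / K]. *)
Lemma len_le_genset N K s l : submod A N -> len_le A T K A l -> K `<=` A ->
  {in s, forall g k, K k -> N (k * g)} ->
  len_le A T N (genset N s) (size s * l).
Proof.
move=> hN le KA; elim: s => /= [|g s IH] KN.
  have [_ h] : len_is A T N N 0 by apply: len_is0 => //; apply: lsub_refl.
  by move=> n /h.
rewrite mulSn addnC; apply: (@len_le_add _ A T hA TA hT _ (genset N s)) => //.
- exact: submod_genset.
- exact: (submod_genset (g :: s)).
- exact: subset_genset.
- by apply: subset_addl; exists 0; rewrite ?mul0r //; apply: subring0.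
- by apply: IH => h hs; apply: KN; rewrite inE hs orbT.
- apply: len_le_cyclic le; first exact: submod_genset.
  by move=> k Kk; split; [apply: KA|apply/subset_genset/KN => //; rewrite inE eqxx].
Qed.

Section Powers.
Variable p : Q.
Hypothesis Ap : A p.

Let Apow i : A (p ^+ i).
Proof.
have [A1 _ AM] := hA.
by elim: i => [|i IH]; rewrite ?expr0 // exprS; apply: AM.
Qed.

Definition powset N i := addset N (scaleset A (p ^+ i)).

Lemma submod_powset N i : submod A N -> submod A (powset N i).
Proof. by move=> hN; apply/submod_addset/submod_scaleset/subring_submod. Qed.

Lemma powset_pow N i : submod A N -> powset N i (p ^+ i).
Proof.
move=> [N0 _ _]; apply: subset_addr => //; exists 1; rewrite ?mul1r //.
by case: hA.
Qed.

Lemma subset_powset N i : N `<=` powset N i.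
Proof. by apply: subset_addl; exists 0; rewrite ?mul0r //; apply: subring0. Qed.

Lemma powsetS N i : powset N i.+1 `<=` powset N i.
Proof.
move=> _ [x [_ [Nx [a Aa <-] ->]]]; exists x, (a * p ^+ i.+1); split=> //.
by exists (a * p); rewrite ?exprS ?mulrA //; case: hA => _ _; apply.
Qed.

Lemma powset0 N : submod A N -> N `<=` A -> powset N 0 = A.
Proof.
move=> [N0 _ _] NA; apply/seteqP; split=> [_ [x [_ [/NA Ax [a Aa <-] ->]]]|a Aa].
  by rewrite expr0 mulr1; apply: subringD.
by exists 0, a; split; rewrite ?add0r //; exists a; rewrite ?expr0 ?mulr1.
Qed.

Lemma powset_step N i : submod A N ->
  powset N i = addset (powset N i.+1) (scaleset A (p ^+ i)).
Proof.
move=> hN; apply/seteqP; split=> [_ [x [y [Nx Py ->]]]|].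
  by exists x, y; split=> //; apply: subset_powset.
apply: (addset_min (submod_powset i hN)); first exact: powsetS.
by apply: subset_addr; case: hN.
Qed.

Variables (q N : set Q).
Hypotheses (qT : forall x, A x -> q x \/ T x) (hN : submod A N) (NA : N `<=` A)
  (qp : lsub T q (powset N 1)).

(** The layer is generated by [p ^+ i] and killed by [N + p A], which locally contains [q]. *)
Lemma len_le_powset_step i : len_le A T (powset N i.+1) (powset N i) 1.
Proof.
rewrite [powset N i]powset_step //; apply: (len_le_cyclic (K := powset N 1)).
- exact: submod_powset.
- have [_ _ AM] := hA; move=> _ [x [_ [Nx [a Aa <-] ->]]]; split.
    by apply: subringD; [|apply: NA|apply: AM => //; apply: (Apow 1)].
  exists (x * p ^+ i), (a * p ^+ i.+1); split; last by rewrite [p ^+ i.+1]exprS expr1; ring.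
    by rewrite mulrC; case: hN => _ _; apply.
  by exists a.
- exact: len_le_maximal qT qp.
Qed.

Lemma len_le_powset i : len_le A T (powset N i) A i.
Proof.
elim: i => [|i IH].
  rewrite powset0 //; have [_ h] : len_is A T A A 0 by apply: len_is0 => //; apply: lsub_refl.
  by move=> n /h.
rewrite -add1n; apply: (@len_le_add _ A T hA TA hT _ (powset N i)) => //.
- exact: submod_powset.
- exact: submod_powset.
- exact: subring_submod.
- exact: powsetS.
- by rewrite -(powset0 hN NA); elim: i {IH} => // i IH; apply: subset_trans IH; apply: powsetS.
- exact: len_le_powset_step.
Qed.

Lemma len_is_powset e :
  (forall i s, (i < e)%N -> T s -> ~ powset N i.+1 (s * p ^+ i)) ->
  len_is A T (powset N e) A e.
Proof.
move=> H; split; last exact: len_le_powset.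
elim: e H => [|e IH] H; first by rewrite powset0 //; apply: Chain0.
rewrite -add1n; apply: (chain_cat (P := powset N e)).
  apply: (ChainS (N' := powset N e)); [exact: powsetS|exact: submod_powset| |exact: Chain0].
  by move=> /(_ _ (powset_pow e hN))[s Ts]; apply: H.
by apply: IH => i s ie; apply: H; apply: ltnW.
Qed.

End Powers.
End Bounds.

(** * Comparison of [R/I] with [S/SI] and divisibility of the length *)

Section Divisibility.
Variable Q : comNzRingType.
Variables (R S T I J B : set Q) (k e : nat).
Hypotheses (hR : subring R) (hS : subring S) (RS : R `<=` S)
  (TR : T `<=` R) (hT : mulset T)
  (hI : submod R I) (IR : I `<=` R) (IJ : prodset I J = R)
  (SR_fin : len_le R T R S k) (lenI : len_is R T I R e)
  (hB : submod S B) (BS : B `<=` S).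

Fixpoint powprod m : set Q := if m is m'.+1 then prodset B (powprod m') else S.

Lemma submod_powprod m : submod S (powprod m).
Proof. by elim: m => [|m IH]; [apply: subring_submod|apply: submod_prodset]. Qed.

Lemma powprodS m : powprod m.+1 `<=` powprod m.
Proof.
elim: m => [|m IH] /=; last exact: prodsetS.
by move=> x; rewrite prodsetC prodset_id // => /BS.
Qed.

Lemma powprod_sub m : powprod m `<=` S.
Proof. by elim: m => // m IH; apply: subset_trans IH; apply: powprodS. Qed.

Theorem length_dvd m : (0 < m)%N -> prodset S I = powprod m -> (m %| e)%N.
Proof.
case: m => // m _ SI.
have subR M : submod S M -> submod R M by apply: submod_sub.
have hSR : submod R S by apply/subR/subring_submod.
have hRR := subring_submod hR.
have SRS : prodset S R = S by rewrite prodsetC prodset_id.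
(* After the case split the exponent is [m.+1], and [B^(m+1) J = S I J = S] exhibits [B^m J] as the
   inverse of [B]. *)
have BB : prodset B (prodset (powprod m) J) = S.
  by rewrite prodsetA -/(powprod m.+1) -SI -prodsetA IJ.
have hSI : submod S (prodset S I) by rewrite SI; apply: submod_powprod.
have ISI : I `<=` prodset S I.
  by move=> x Ix; rewrite -[x]mul1r; apply: prodset_mul => //; case: hS.
have SIS : prodset S I `<=` S by rewrite SI; apply: powprod_sub.
have [k' lenRS] := len_is_exists RS SR_fin.
have lenISI : len_is R T I (prodset S I) k'.
  rewrite [prodset S I]prodsetC -{1}(prodset_id hR hI) prodsetC.
  by apply: (len_is_prodset hR TR hT (J := J)) => //; rewrite prodsetC.
(* The two routes from [I] to [S], through [R] and through [S I], give [e + k' = k' + l]; finiteness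
   of [k'] allows the cancellation. *)
have lenIS := len_is_add hR TR hT hI hRR hSR IR RS lenI lenRS.
have [i [l [leni lenl E]]] :=
  len_is_between hR TR hT hI (subR _ hSI) hSR ISI SIS lenIS.
have {E leni} le : l = e by rewrite (len_is_uniq leni lenISI) in E; lia.
rewrite {l}le SI in lenl.
(* [S / B] inherits finite length from [S / B^(m+1)]; this length is the common one of all
   layers. *)
have [|a [l [_ lenB _]]] :=
  len_is_between hR TR hT (subR _ (submod_powprod m.+1)) (subR _ hB) hSR _ BS lenl.
  elim: (m) => [|m' IH]; first by rewrite /= prodsetC prodset_id.
  by apply: subset_trans IH; apply: powprodS.
have step j : len_is R T (powprod j.+1) (powprod j) l.
  elim: j => [|j IH]; first by rewrite /= prodsetC prodset_id.
  apply: (len_is_prodset_invertible hR hS RS TR hT BB _ _ _ IH).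
  - exact: (submod_powprod j.+1).
  - exact: (submod_powprod j).
  - exact: powprodS.
have lenm j : len_is R T (powprod j) S (j * l).
  elim: j => [|j IH]; first by apply: len_is0 => //; apply: lsub_refl.
  rewrite mulSn; apply: (@len_is_add _ R T hR TR hT _ (powprod j)) => //.
  - exact/subR/submod_powprod.
  - exact/subR/submod_powprod.
  - exact: powprodS.
  - exact: powprod_sub.
by rewrite (len_is_uniq lenl (lenm _)) dvdn_mulr.
Qed.

End Divisibility.

(** * Ideals *)

Section SpanTheory.
Variables (A : pzRingType) (M : lmodType A).

Lemma submod_span_sub (X : set M) x : X x -> x \in submod_span X.
Proof.
move=> Xx; apply/asboolP; exists 1%N, (fun=> 1), (fun=> x).
by split=> //; rewrite big_ord1 scale1r.
Qed.

Lemma submod_span_ind (X P : set M) : P 0 -> (forall x y, P x -> P y -> P (x + y)) ->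
  (forall a x, X x -> P (a *: x)) -> forall x, x \in submod_span X -> P x.
Proof.
move=> P0 PD PZ x /asboolP[n [c [g [gX ->]]]].
by elim/big_ind: _ => // i _; apply: PZ.
Qed.

Lemma submod_span_seq (s : seq M) x : x \in submod_span [set` s] ->
  exists c : 'I_(size s) -> A, x = \sum_(i < size s) c i *: s`_i.
Proof.
move: x; apply: submod_span_ind => [|_ _ [c ->] [d ->]|a x /= xs].
- by exists (fun=> 0); rewrite big1 // => i _; rewrite scale0r.
- exists (fun i => c i + d i); rewrite -big_split.
  by apply: eq_bigr => i _; rewrite scalerDl.
- have lt : (index x s < size s)%N by rewrite index_mem.
  exists (fun i => if i == Ordinal lt then a else 0).
  rewrite (bigD1 (Ordinal lt)) //= eqxx nth_index // big1 ?addr0 // => i /negPf ->.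
  by rewrite scale0r.
Qed.

End SpanTheory.

Section Ideals.
Variable A : comNzRingType.
Implicit Types (N M p q X : set A) (I J : ideal A).

Lemma subring_setT : subring [set: A].
Proof. by []. Qed.

Lemma span_ideal N x : submod setT N -> (x \in @submod_span A A^o N) <-> N x.
Proof.
move=> [N0 ND NM]; split; last exact: submod_span_sub.
by move: x; apply: submod_span_ind => // a x; apply: NM.
Qed.

Lemma submod_ideal I : @submod A setT [set` I].
Proof.
split=> [|x y xI yI|a x _ xI]; first exact: (rpred0 I).
  exact: (rpredD (S := I)).
exact: (@rpredZ _ _ I a).
Qed.

Lemma in_submod_mul I J x :
  (x \in submod_mul (I : submodClosed A^o) J) <-> @prodset A [set` I] [set` J] x.
Proof.
split.
  move: x; apply: submod_span_ind => [|x y|a _ [x xI [y yJ <-]]].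
  - exact: Prodset0.
  - exact: prodsetD.
  - have [_ _ PM] := @submod_prodset A setT [set` I] _ (submod_ideal J).
    by apply: PM => //; apply: prodset_mul.
elim=> [|{}x y z xI yJ _ IH]; first exact: (rpred0 (submod_mul I J)).
apply: (rpredD (S := submod_mul I J)) => //; apply: submod_span_sub.
by exists x => //; exists y.
Qed.

Lemma in_ideal_exp I m x : (x \in ideal_exp I m) <-> @powprod A setT [set` I] m x.
Proof.
elim: m x => [|m IH] x //=.
rewrite in_submod_mul; suff -> : [set` ideal_exp I m] = @powprod A setT [set` I] m by [].
by apply/seteqP; split=> y /= /IH.
Qed.

Definition primeset p :=
  [/\ submod setT p, ~ p 1 & forall x y, p (x * y) -> p x \/ p y].

Lemma maximal_prime p : maximal_avoiding setT [set 1] p -> primeset p.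
Proof.
move=> [hp p1 pmax]; split=> //; first by move=> /p1; apply.
move=> x y pxy; have [px|npx] := pselect (p x); [by left|right].
have hM : submod setT (addset p (scaleset setT x)).
  by apply/submod_addset/submod_scaleset.
have pM : p `<=` addset p (scaleset setT x).
  by apply: subset_addl; exists 0; rewrite ?mul0r.
apply: contrapT => npy; apply: npx; apply: (pmax _ hM pM) => [z Mz z1|].
  case: Mz => a [_ [pa [b _ <-] e]]; apply: npy.
  have -> : y = y * a + b * (x * y) by rewrite -[LHS]mulr1 -z1 e; ring.
  by case: hp => _ pD pM'; apply: pD; apply: pM'.
by apply: subset_addr; [case: hp|exists 1; rewrite ?mul1r].
Qed.

Lemma maximal_ideal_above N : submod setT N -> ~ N 1 ->
  exists2 p, N `<=` p & maximal_avoiding setT [set 1] p.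
Proof.
by move=> hN N1; apply: maximal_avoiding_exists => // x Nx x1; rewrite x1 in Nx.
Qed.

Lemma mulset_prime p : primeset p -> mulset (~` p).
Proof. by move=> [_ p1 pP]; split=> // x y npx npy /pP[]. Qed.

Lemma prime_exp p x n : primeset p -> ~ p x -> ~ p (x ^+ n).
Proof.
move=> /mulset_prime[p1 pM] px; elim: n => [|n IH]; rewrite ?expr0 // exprS.
exact: pM.
Qed.

Lemma noetherian_fg N : noetherian A -> submod setT N ->
  exists2 s : seq A, {in s, forall y, N y} & forall x, N x ->
    exists c : 'I_(size s) -> A, x = \sum_(i < size s) c i * s`_i.
Proof.
move=> noeth hN; have [s sP] := noeth (@submod_span A A^o N).
have sN y : y \in s -> N y.
  by move=> ys; apply/(span_ideal y hN); rewrite sP; apply: submod_span_sub.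
exists s => [//|x Nx].
have [|c ->] := @submod_span_seq A A^o s x; last by exists c.
by rewrite -sP; apply: submod_span_sub.
Qed.

(** The union of a chain of ideals is finitely generated, so one member contains the generators and
    equals the union. *)
Lemma noetherian_max (F : set (set A)) N0 : noetherian A ->
  (forall N, F N -> submod setT N) -> F N0 ->
  exists2 N, F N & forall M, F M -> N `<=` M -> M `<=` N.
Proof.
move=> noeth Fsub FN0.
apply: Zorn_bigcup_nonempty FN0 _ => G X0 GX0 GF totG.
have GS X : G X -> submod setT X by move=> /GF/Fsub.
set U := \bigcup_(X in G) X.
have hU : submod setT U.
  split=> [|x y [X GX Xx] [Y GY Yy]|a x _ [X GX Xx]].
  - by exists X0 => //; case: (GS _ GX0).
  - have [XY|YX] := totG X Y GX GY.
      by exists Y => //; case: (GS _ GY) => _ YD _; apply: YD => //; apply: XY.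
    by exists X => //; case: (GS _ GX) => _ XD _; apply: XD => //; apply: YX.
  - by exists X => //; case: (GS _ GX) => _ _; apply.
have [s sU sP] := noetherian_fg noeth hU.
have [X GX sX] : exists2 X, G X & {in s, forall y, X y}.
  elim: (s) sU => [|y t IH] ytU; first by exists X0.
  have [|X GX tX] := IH; first by move=> z zt; apply: ytU; rewrite inE zt orbT.
  have [Y GY Yy] := ytU y (mem_head _ _).
  have [XY|YX] := totG X Y GX GY.
    by exists Y => // z; rewrite inE => /orP[/eqP ->|/tX/XY].
  by exists X => // z; rewrite inE => /orP[/eqP ->|/tX//]; apply: YX.
suff -> : U = X by apply: GF.
apply/seteqP; split=> [y /sP[c ->]|y Xy]; last by exists X.
have [N0' ND NM] := GS _ GX; elim/big_ind: _ => // i _; apply: NM => //.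
by apply/sX/mem_nth.
Qed.

End Ideals.

(** * Dedekind domains *)

Section Dedekind.
Variable Z : idomainType.
Hypothesis dedZ : dedekind Z.
Implicit Types (a b p N : set Z) (x y z u t s c d pi : Z).

Let noethZ : noetherian Z. Proof. by case: dedZ. Qed.

(** Otherwise [0], [p], [q] form a strict chain of three primes, [c] separating the first two. *)
Lemma dedekind_prime_max p q c : primeset p -> primeset q -> c != 0 -> p c ->
  p `<=` q -> q `<=` p.
Proof.
move=> hp hq c0 pc pq; case: dedZ => _ _ dim1; apply: contrapT => nqp.
pose N i := match i with 0 => [set 0] | 1 => p | _ => q end : set Z.
have hN i : primeset (N i).
  case: i => [|[|i]] //; split=> [|/eqP|x y /eqP]; last 2 first.
  - by rewrite oner_eq0.
  - by rewrite mulf_eq0 => /orP[]/eqP; [left|right].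
  split=> // [_ _ -> ->|e _ _ ->]; first by rewrite addr0.
  by rewrite mulr0.
have inN i x : (x \in @submod_span Z Z^o (N i)) <-> N i x.
  by apply: span_ideal; case: (hN i).
apply: (dim1 (fun i => @submod_span Z Z^o (N i) : ideal Z)) => [i _|[|[|i]] // _].
- have [_ N1 NM] := hN i; split; first by apply/negP => /inN.
  by move=> x y /inN/NM[] /inN ->; rewrite ?orbT.
- split; last by move=> /(_ c) h; have /inN/eqP := h (proj2 (inN 1 c) pc); rewrite (negPf c0).
  by move=> x /inN ->; apply/inN; case: (hp) => -[].
- split; first by move=> x /inN px; apply/inN/pq.
  by move=> h; apply: nqp => x qx; apply/(inN 1)/h/inN.
Qed.

(** Stability of [p] under [d / c] makes [d / c] an eigenvalue of a matrix over [Z], with the row of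
    generators of [p] as eigenvector; so [d / c] is integral over [Z]. *)
Lemma integral_ideal p c d : submod setT p -> (exists2 x, p x & x != 0) -> c != 0 ->
  (forall x, p x -> exists2 w, p w & x * d = c * w) -> exists x, d = c * x.
Proof.
move=> hp [x0 px0 x00] c0 hd; case: dedZ => _ intZ _.
have [s sp sP] := noetherian_fg noethZ hp; set n := size s in sP.
have [|a aE] := @choice _ _ (fun (j : 'I_n) (aj : 'I_n -> Z) =>
    s`_j * d = c * \sum_(i < n) aj i * s`_i).
  move=> j; have [|w pw ->] := hd s`_j; first exact/sp/mem_nth.
  by have [b ->] := sP _ pw; exists b.
pose th := tofrac d / tofrac c.
have fc0 : tofrac c != 0 by rewrite tofrac_eq0.
pose M := \matrix_(i < n, j < n) a j i.
have [x ex] : exists x, th = tofrac x; last first.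
  exists x; apply/eqP; rewrite -tofrac_eq tofracM -ex mulrC divfK //.
apply: intZ; exists (char_poly M); first exact: char_poly_monic.
rewrite map_char_poly -eigenvalue_root_char; apply/eigenvalueP.
exists (\row_j tofrac s`_j).
  apply/rowP => j; rewrite !mxE; apply: (mulfI fc0).
  rewrite [RHS]mulrA [_ * th]mulrC divfK // -[RHS]tofracM [d * _]mulrC aE tofracM; congr (_ * _).
  by rewrite rmorph_sum; apply: eq_bigr => i _; rewrite !mxE -tofracM mulrC.
apply: contra_neq x00 => /rowP s0; have [b ->] := sP _ px0.
apply: big1 => i _; have := s0 i; rewrite !mxE => /eqP; rewrite tofrac_eq0 => /eqP ->.
by rewrite mulr0.
Qed.

(* [pi] generates the maximal ideal of the localization at [p]. *)
Definition uniformizer p pi s := [/\ p pi, ~ p s & forall x, p x -> exists w, s * x = pi * w].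

(* A maximal ideal [(c : d)] contained in [p] is prime, hence equal to [p]; then
   [(d / c) p] is not contained in [p], or else [d / c] would be integral. *)
Lemma uniformizer_exists p c : primeset p -> c != 0 -> p c ->
  exists pi s, uniformizer p pi s.
Proof.
move=> hp c0 pc; have [hpm p1 pP] := hp.
pose col d := [set z | exists w, z * d = c * w].
have hcol d : submod setT (col d).
  split=> [|x y [w e] [v f]|a x _ [w e]].
  - by exists 0; rewrite mul0r mulr0.
  - by exists (w + v); rewrite mulrDl e f mulrDr.
  - by exists (a * w); rewrite -mulrA e mulrCA.
have [||N [d Nd Np] Nmax] :=
  @noetherian_max _ [set N | exists2 d, N = col d & N `<=` p] (col 1) noethZ.
- by move=> _ [d -> _].
- exists 1 => // z [w]; rewrite mulr1 => ->; case: hpm => _ _ pM.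
  by rewrite mulrC; apply: pM.
subst N.
have colM x : col d `<=` col (d * x).
  by move=> z [w e]; exists (w * x); rewrite mulrA e mulrA.
have colp : primeset (col d).
  split=> // [/Np //|x y [w xy]].
  (* If [col (d * x)] lies in [p], maximality gives [y]. Otherwise it has an element [t] outside
     [p]; then [col (d * t)] contains [x] and lies in [p], and maximality gives [x]. *)
  have [h|nx] := pselect (col (d * x) `<=` p).
    right; apply: (Nmax (col (d * x))); [by exists (d * x)|exact: colM|exists w; rewrite -xy; ring].
  left; have [t [[v tv] npt]] : exists t, col (d * x) t /\ ~ p t.
    apply: contrapT => no; apply: nx => z cz; apply: contrapT => npz.
    by apply: no; exists z.
  apply: (Nmax (col (d * t))); [exists (d * t) => //|exact: colM|exists v; rewrite -tv /=; ring].
  move=> z [w' e]; have /Np/pP[//|//] : col d (z * t) by exists w'; rewrite -e; ring.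
have pcol : p `<=` col d.
  apply: (dedekind_prime_max colp hp c0 _ Np); exists d; ring.
have [pi [w [ppi npw e]]] : exists pi w, [/\ p pi, ~ p w & pi * d = c * w].
  apply: contrapT => no.
  have [||x dx] := @integral_ideal p c d hpm _ c0; first by exists c.
    move=> x /[dup] px /pcol[w e]; exists w => //; apply: contrapT => npw.
    by apply: no; exists x, w.
  by apply: p1; apply: Np; exists x; rewrite mul1r.
(* From [pi * d = c * w] and [x * d = c * v] one gets [c * (w * x) = c * (pi * v)]. *)
exists pi, w; split=> // x /pcol[v f]; exists v.
by apply: (mulfI c0); rewrite mulrA -e mulrCA -f; ring.
Qed.

(** Take a counterexample [z1] for which [loc z1], the ideal it generates locally, is maximal. It
    lies in [p], so [s * z1 = pi * z2], and [z2] is again a counterexample. Maximality makes the two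
    local ideals agree, and [pi] becomes a local unit. *)
Lemma uniformizer_decomp p pi s z : primeset p -> uniformizer p pi s -> z != 0 ->
  exists k t u, [/\ ~ p t, ~ p u & t * z = u * pi ^+ k].
Proof.
move=> hp [ppi nps hs]; have [hpm p1 pP] := hp.
have pi0 : p 0 by case: hpm.
pose loc z := [set y | exists t w, ~ p t /\ t * y = w * z].
pose good z := exists k t u, [/\ ~ p t, ~ p u & t * z = u * pi ^+ k].
move=> z0; apply: contrapT => bad.
have [||N [z1 [z10 bad1 ->]] Nmax] :=
  @noetherian_max _ [set N | exists z, [/\ z != 0, ~ good z & N = loc z]] (loc z) noethZ.
- move=> _ [y [_ _ ->]]; split=> [|x1 x2 [t [w [pt e]]] [t' [w' [pt' e']]]|a x _ [t [w [pt e]]]].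
  + by exists 1, 0; rewrite mulr0 mul0r.
  + exists (t * t'), (t' * w + t * w'); split; first by move=> /pP[].
    by rewrite mulrDr mulrDl -[t * t' * x1]mulrA [t * (_ * _)]mulrCA e -[_ * _ * x2]mulrA e'; ring.
  + by exists t, (a * w); split=> //; rewrite mulrCA e mulrA.
- by exists z.
have pz1 : p z1.
  by apply: contrapT => npz1; apply: bad1; exists 0, 1, z1; rewrite expr0 mulr1 mul1r.
have [z2 e2] := hs _ pz1.
have s0 : s != 0 by apply/eqP => s0; rewrite s0 in nps.
have z20 : z2 != 0.
  by apply/eqP => z20; move/eqP: e2; rewrite z20 mulr0 mulf_eq0 (negPf s0) (negPf z10).
have bad2 : ~ good z2.
  move=> [k [t [u [npt npu e]]]]; apply: bad1; exists k.+1, (t * s), u; split=> //.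
    by move=> /pP[].
  by rewrite -mulrA e2 mulrCA e exprS; ring.
have [|||t [w [npt e]]] := Nmax (loc z2) _ _ z2.
- by exists z2.
- move=> y [t [w [npt e]]]; exists (s * t), (w * pi); split; first by move=> /pP[].
  by rewrite -mulrA e mulrCA e2; ring.
- by exists 1, 1; rewrite !mul1r.
have : t * s = w * pi.
  apply: (mulfI z20).
  have -> : z2 * (t * s) = s * (t * z2) by ring.
  by rewrite e mulrCA e2; ring.
move=> ets; have : p (t * s) by rewrite ets; case: hpm => _ _; apply.
by move=> /pP[].
Qed.

(** The exponent is the least valuation at [p] of a nonzero element of [a]. *)
Lemma ideal_local_exponent p pi s a : primeset p -> uniformizer p pi s ->
  submod setT a -> (exists2 x, a x & x != 0) ->
  exists e, (exists2 u, ~ p u & a (u * pi ^+ e)) /\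
    (forall y, a y -> exists t w, ~ p t /\ t * y = w * pi ^+ e).
Proof.
move=> hp hpi ha [x ax x0].
have [k [t [u [npt npu e]]]] := uniformizer_decomp hp hpi x0.
have aM y z : a z -> a (y * z) by case: ha => _ _; apply.
have ex : exists e, (fun e => `[< exists2 u, ~ p u & a (u * pi ^+ e) >]) e.
  by exists k; apply/asboolP; exists u => //; rewrite -e; apply: aM.
case: (ex_minnP ex) => e0 /asboolP hu emin; exists e0; split=> // y ay.
have [->|y0] := eqVneq y 0.
  by exists 1, 0; case: hp => _ p1 _; rewrite mulr0 mul0r.
have [k' [t' [u' [npt' npu' e']]]] := uniformizer_decomp hp hpi y0.
have le : (e0 <= k')%N.
  by apply: emin; apply/asboolP; exists u' => //; rewrite -e'; apply: aM.
by exists t', (u' * pi ^+ (k' - e0)); split=> //; rewrite -mulrA -exprD subnK.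
Qed.

(** The ideal [(a : y)] lies in no maximal ideal. One containing it would also contain [x], so
    testing nonzero primes suffices. *)
Lemma ideal_mem_local a y : submod setT a -> (exists2 x, a x & x != 0) ->
  (forall p, primeset p -> (exists2 x, p x & x != 0) -> exists2 t, ~ p t & a (t * y)) -> a y.
Proof.
move=> ha [x ax x0] h.
have hK : submod setT [set t | a (t * y)].
  have [a0 aD aM] := ha; split=> [|t t' at_ at'|b t _ at_] /=.
  - by rewrite mul0r.
  - by rewrite mulrDl; apply: aD.
  - by rewrite -mulrA; apply: aM.
apply: contrapT => nay; have [|p Kp /maximal_prime hp] := maximal_ideal_above hK.
  by rewrite /= mul1r.
have [|t npt /Kp //] := h p hp.
by exists x => //; apply: Kp; rewrite /= mulrC; case: ha => _ _; apply.
Qed.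

Lemma local_root p pi s k m z w t : primeset p -> uniformizer p pi s -> (0 < m)%N ->
  ~ p t -> t * z ^+ m = w * pi ^+ (m * k) ->
  exists t w, ~ p t /\ t * z = w * pi ^+ k.
Proof.
move=> hp hpi m0 npt e; have [ppi nps _] := hpi; have [hpm p1 pP] := hp.
have [->|z0] := eqVneq z 0; first by exists 1, 0; rewrite mulr0 mul0r.
have [j [t' [u [npt' npu e']]]] := uniformizer_decomp hp hpi z0.
(* Truncated subtraction: the witness is meaningful for [k <= j], and [j < k] is refuted. *)
exists t', (u * pi ^+ (j - k)); split=> //.
have [kj|jk] := leqP k j; first by rewrite -mulrA -exprD subnK.
exfalso; have uj0 : u * pi ^+ j != 0.
  rewrite -e' mulf_neq0 //; apply/eqP => t0; apply: npt'.
  by rewrite t0; case: hpm.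
have pij0 : pi ^+ (j * m) != 0.
  by rewrite exprM expf_neq0 //; apply: contraNneq uj0 => ->; rewrite mulr0.
(* After cancelling [pi ^+ (j * m)] a positive power of [pi] remains; the factor [pi] split off puts
   the left side into [p], while the right side is outside. *)
have E : t' ^+ m * w * pi ^+ (m * (k - j)).-1 * pi = t * u ^+ m.
  have Epi : pi ^+ (j * m) * (pi ^+ (m * (k - j)).-1 * pi) = pi ^+ (m * k).
    rewrite -exprSr prednK ?muln_gt0 ?m0 ?subn_gt0 // -exprD; congr (_ ^+ _).
    by rewrite mulnBr [(j * m)%N]mulnC subnKC // leq_mul2l ltnW ?orbT.
  apply: (mulfI pij0); rewrite -[t' ^+ m * w * _ * _]mulrA mulrCA Epi -mulrA -e.
  by rewrite mulrCA -exprMn e' exprMn -exprM mulrA mulrC.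
have: p (t * u ^+ m) by rewrite -E; case: hpm => _ _; apply.
by case/pP => //; apply: prime_exp.
Qed.

Lemma ideal_root a m : (0 < m)%N -> submod setT a -> (exists2 x, a x & x != 0) ->
  (forall p pi s e, primeset p -> uniformizer p pi s ->
     (exists2 u, ~ p u & a (u * pi ^+ e)) ->
     (forall y, a y -> exists t w, ~ p t /\ t * y = w * pi ^+ e) -> (m %| e)%N) ->
  exists b : ideal Z, forall x, (x \in ideal_exp b m) <-> a x.
Proof.
move=> m0 ha [c ac c0] hm; have [a0 aD aM'] := ha.
have aM y z : a z -> a (y * z) by apply: aM'.
have loc p : primeset p -> (exists2 x, p x & x != 0) ->
    exists pi s k u, [/\ uniformizer p pi s, ~ p u, a (u * pi ^+ (m * k))
      & forall y, a y -> exists t w, ~ p t /\ t * y = w * pi ^+ (m * k)].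
  move=> hp [x px x0]; have [pi [s hpi]] := uniformizer_exists hp x0 px.
  have [|e [hu hy]] := ideal_local_exponent hp hpi ha; first by exists c.
  have /dvdnP[k ek] := hm _ _ _ _ hp hpi hu hy; case: hu => u npu au.
  by exists pi, s, k, u; rewrite mulnC -ek.
pose b := [set z | a (z ^+ m)].
have bloc p pi s k z : primeset p -> uniformizer p pi s ->
    (forall y, a y -> exists t w, ~ p t /\ t * y = w * pi ^+ (m * k)) ->
    b z -> exists t w, ~ p t /\ t * z = w * pi ^+ k.
  by move=> hp hpi hy /hy[t [w [npt e]]]; apply: (local_root hp hpi m0 npt e).
have hb : submod setT b.
  split=> [|x y bx by_|d x _ bx]; last by rewrite /b /= exprMn; apply: aM.
    by rewrite /b /= expr0n eqn0Ngt m0.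
  (* Closure under addition is not formal; it holds because at each [p] the elements of [b] have
     valuation at least [k], so the [m]-th power of a sum has valuation at least [m * k]. *)
  apply: (ideal_mem_local ha); first by exists c.
  move=> p hp np; have [pi [s [k [u [hpi npu au hy]]]]] := loc p hp np.
  have [t [w [npt e]]] := bloc p pi s k x hp hpi hy bx.
  have [t' [w' [npt' e']]] := bloc p pi s k y hp hpi hy by_.
  have [_ pM] := mulset_prime hp.
  exists (u * (t * t') ^+ m); first by apply: (pM) => //; apply: prime_exp => //; apply: pM.
  have -> : u * (t * t') ^+ m * (x + y) ^+ m = (t' * w + t * w') ^+ m * (u * pi ^+ (m * k)).
    rewrite -mulrA -exprMn mulnC exprM [RHS]mulrCA -exprMn; congr (_ * _ ^+ _).
    have -> : t * t' * (x + y) = t' * (t * x) + t * (t' * y) by ring.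
    by rewrite e e'; ring.
  exact: aM.
pose P := powprod setT b.
have hP i : submod setT (P i) by apply: submod_powprod.
have bP x i : b x -> P i (x ^+ i).
  by move=> bx; elim: i => // i IH; rewrite exprS; apply: prodset_mul.
have PM i y z : P i z -> P i (y * z) by case: (hP i) => _ _; apply.
have Pa : P m `<=` a.
  move=> z Pz; apply: (ideal_mem_local ha) => [|p hp np]; first by exists c.
  have [pi [s [k [u [hpi npu au hy]]]]] := loc p hp np.
  have [p1 pM] := mulset_prime hp.
  suff [t [w [npt e]]] : exists t w, ~ p t /\ t * z = w * pi ^+ (m * k).
    exists (u * t); first exact: pM.
    by rewrite -mulrA e mulrCA; apply: aM.
  elim: (m) z Pz => [|i IH] z; first by exists 1, z; rewrite expr0 mulr1 mul1r.
  move: z; apply: prodset_ind' => [|x y [t [w [npt e]]] [t' [w' [npt' e']]]|x y bx /IH].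
  - by exists 1, 0; rewrite mulr0 mul0r.
  - exists (t * t'), (t' * w + t * w'); split; first exact: pM.
    have -> : t * t' * (x + y) = t' * (t * x) + t * (t' * y) by ring.
    by rewrite e e'; ring.
  - move=> [t [w [npt e]]]; have [t' [w' [npt' e']]] := bloc p pi s k x hp hpi hy bx.
    exists (t' * t), (w' * w); split; first exact: pM.
    by rewrite mulrACA e e' mulSn exprD mulrACA.
have aP : a `<=` P m.
  move=> y ay; apply: (ideal_mem_local (hP m)) => [|p hp np].
    exists (c ^+ m); last by rewrite expf_neq0.
    by apply: bP; rewrite /b /= -(prednK m0) exprS mulrC; apply: aM.
  have [pi [s [k [u [hpi npu au hy]]]]] := loc p hp np.
  have [p1 pM] := mulset_prime hp.
  have [t [w [npt e]]] := hy y ay.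
  (* Surplus factors [u] turn the local generator [u * pi ^+ (m * k)] of [a] into the [m]-th power
     of [u * pi ^+ k], an element of [b]. *)
  exists (u ^+ m * t); first by apply: pM => //; apply: prime_exp.
  have -> : u ^+ m * t * y = w * (u * pi ^+ k) ^+ m.
    by rewrite -mulrA e exprMn -exprM [(k * m)%N]mulnC; ring.
  apply/PM/bP; rewrite /b /= exprMn -exprM [(k * m)%N]mulnC -(prednK m0) exprS.
  by rewrite [u * _]mulrC -mulrA prednK //; apply: aM.
exists (@submod_span Z Z^o b : ideal Z) => x; rewrite in_ideal_exp.
suff -> : [set` @submod_span Z Z^o b] = b by split=> [/Pa|/aP].
by apply/seteqP; split=> y /(span_ideal y hb).
Qed.

End Dedekind.

(** * Finite étale algebras *)

Section SeparabilityElement.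
Variables (A B : comPzRingType) (f : {rmorphism A -> B}).
Local Notation E := (tensor f f).
Local Open Scope quotient_scope.

Definition mult_lin : E^o -> restrict (mult_map f) := mult_map f.

Lemma mult_lin_linear : linear mult_lin.
Proof. by move=> a x y; rewrite /mult_lin rmorphD rmorphM. Qed.
HB.instance Definition _ := GRing.isLinear.Build E E^o (restrict (mult_map f)) _
  mult_lin mult_lin_linear.

(** [s] represents the image of [1] under a linear section of the multiplication map; [b ⊗ 1] and
    [1 ⊗ b] act alike on [B], hence agree on this image. *)
Lemma separability_element : separable_algebra f ->
  exists s : seq (B * B), \sum_(p <- s) p.1 * p.2 = 1 /\
    forall b, tensor_eqv f f [seq (b * p.1, p.2) | p <- s] [seq (p.1, b * p.2) | p <- s].
Proof.
move=> /(_ _ _ mult_lin idfun)[y|v vP].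
  by exists (\pi_(tensor f f) [:: (y, 1)]); rewrite /= /mult_lin mult_mapE /seq_sum big_seq1 mulr1.
have [s es] := tensor_surj (v 1).
exists s; split; first by have := vP 1; rewrite es /= /mult_lin mult_mapE.
move=> b; pose bl : E := \pi_(tensor f f) [:: (b, 1)].
pose br : E := \pi_(tensor f f) [:: (1, b)].
pose o : restrict (mult_map f) := 1.
have e : bl *: o = br *: o.
  change (mult_map f bl * 1 = mult_map f br * 1); rewrite !mult_mapE /seq_sum !big_seq1 /=.
  by rewrite [b * 1]mulrC.
have := congr1 v e; rewrite !linearZ es => ebl.
have {}ebl : bl * \pi_(tensor f f) s = br * \pi_(tensor f f) s by exact: ebl.
move: ebl; rewrite !tensor_piMr => /tensor_eq; rewrite !seq_mul_cons !cats0 /=.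
by under eq_map do rewrite mul1r; under [X in _ _ X]eq_map do rewrite mul1r.
Qed.

End SeparabilityElement.

Section DualBasis.
Variables (A B : pzRingType) (f : {rmorphism A -> B}) (n : nat) (g : 'I_n -> B).

Definition comb_lin (u : 'rV[A]_n) : restrict f := \sum_j f (u 0 j) * g j.

Lemma comb_lin_linear : linear comb_lin.
Proof.
move=> a x y; rewrite /comb_lin scaler_sumr -big_split; apply: eq_bigr => j _.
by rewrite !mxE rmorphD rmorphM mulrDl -mulrA.
Qed.
HB.instance Definition _ := GRing.isLinear.Build A 'rV[A]_n (restrict f) _
  comb_lin comb_lin_linear.

(** [v] gives the coordinates of a linear section of the surjection from [A^n] defined by the
    generators. *)
Lemma projective_dual_basis : projective (restrict f) ->
  (forall b, exists c : 'I_n -> A, b = \sum_j f (c j) * g j) ->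
  exists v : B -> 'I_n -> A, [/\ forall b, b = \sum_j f (v b j) * g j
    & forall a b j, v (f a * b) j = a * v b j].
Proof.
move=> proj gen; have [b|v vP] := proj _ _ comb_lin idfun.
  have [c ->] := gen b; exists (\row_j c j).
  by apply: eq_bigr => j _; rewrite mxE.
exists (fun b j => v b 0 j); split=> [b|a b j]; first by rewrite -[LHS]vP.
have e : v (a *: (b : restrict f)) = a *: v b by rewrite linearZ.
by have := congr1 (fun u : 'rV_n => u 0 j) e; rewrite mxE.
Qed.

End DualBasis.

Section DetTrick.
Variables (A B : comNzRingType) (f : {rmorphism A -> B}).

Lemma det_sub_ideal (N : set A) n (M : 'M[A]_n) : submod setT N ->
  (forall i j, N (M i j)) -> N (\det (1%:M - M) - 1).
Proof.
move=> [N0 ND NM] hM.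
have cong (I : finType) (F G : I -> A) : (forall i, N (F i - G i)) ->
    N (\prod_i F i - \prod_i G i).
  move=> FG; elim/big_ind2: _ => [|x y z t xy zt|i _]; rewrite ?subrr //.
  have -> : y * t - x * z = t * (y - x) + x * (t - z) by ring.
  by apply: ND; apply: NM.
rewrite -[X in _ - X](det1 A n) /determinant -sumrB.
elim/big_ind: _ => // s _; rewrite -mulrBr; apply: (NM) => //; apply: cong => i.
have E j : (1%:M - M) i j - 1%:M i j = -1 * M i j by rewrite !mxE; ring.
by rewrite E; apply: NM.
Qed.

Lemma det_annihilates n (M : 'M[B]_n) (g : 'cV[B]_n) (N : set B) : submod setT N ->
  (forall i, N ((M *m g) i 0)) -> forall i, N (\det M * g i 0).
Proof.
move=> [N0 ND NM] hM i.
have -> : \det M * g i 0 = (\adj M *m (M *m g)) i 0.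
  by rewrite mulmxA mul_adj_mx mul_scalar_mx mxE.
by rewrite mxE; elim/big_ind: _ => // j _; apply: NM.
Qed.

End DetTrick.

Lemma quot_pi_sum (A : comNzRingType) (I : ideal A) (T : Type) (s : seq T) (F : T -> A) :
  (\pi_(quot I) (\sum_(i <- s) F i) = \sum_(i <- s) \pi_(quot I) (F i))%qT.
Proof.
have pi0 : (\pi_(quot I) 0 = 0 :> quot I)%qT.
  by apply: (addrI (\pi_(quot I) 0)%qT); rewrite -quot_piD !addr0.
by elim: s => [|x s IH]; rewrite ?big_nil // !big_cons quot_piD IH.
Qed.

Section Etale.
Variables (Z R : comNzRingType) (ZR : {rmorphism Z -> R}) (I : ideal R).
Variable (rs : seq R).
Hypothesis rs_gen : forall x, exists c : 'I_(size rs) -> Z, x = \sum_(i < size rs) ZR (c i) * rs`_i.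
Variables (p : set Z) (q : set R).
Hypotheses (hp : submod setT p) (pmax : forall z, ~ p z -> exists w t, p t /\ w * z + t = 1).

(** The ideal [pR + I], so that [R / N] is the fibre of [R / I] over [Z / p]. *)
Definition fiber_ideal : set R := addset (prodset (ZR @` p) setT) [set` I].
Local Notation N := fiber_ideal.
Local Open Scope quotient_scope.

Lemma submod_fiber : submod setT N.
Proof. by apply/submod_addset/submod_ideal/submod_prodset. Qed.

Lemma fiber_p z r : p z -> N (ZR z * r).
Proof.
move=> pz; apply: subset_addl; first exact: (rpred0 I).
by apply: prodset_mul => //; exists z.
Qed.

Lemma fiber_I x : x \in I -> N x.
Proof. by move=> xI; apply: subset_addr => //; apply: Prodset0. Qed.

Lemma fiber_comb z (r : R) : N r -> N (z * r).
Proof. by case: submod_fiber => _ _; apply. Qed.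

(* Otherwise the determinant trick yields an element of [Z] that is congruent to
   1 modulo [p] and lies in the contraction of [I]. *)
Lemma fiber_proper : (forall z, ZR z \in I -> p z) -> ~ p 1 -> ~ N 1.
Proof.
move=> Ip p1 N1; pose n := size rs.
pose P := [set x | exists c : 'I_n -> Z, (forall j, p (c j)) /\
  x - \sum_(j < n) ZR (c j) * rs`_j \in I].
have [p0 pD pM] := hp; have [I0 ID IM] := submod_ideal I.
have NP : N `<=` P.
  move=> _ [x [y [Px Iy ->]]].
  have [c [pc <-]] : exists c : 'I_n -> Z, (forall j, p (c j)) /\ \sum_(j < n) ZR (c j) * rs`_j = x.
    move: x Px; apply: prodset_ind' => [|_ _ [c [pc <-]] [d [pd <-]]|_ r [z pz <-] _].
    - by exists (fun=> 0); split=> //; rewrite big1 // => j _; rewrite rmorph0 mul0r.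
    - exists (fun j => c j + d j); split=> [j|]; first exact: pD.
      by rewrite -big_split; apply: eq_bigr => j _; rewrite rmorphD mulrDl.
    - have [c ->] := rs_gen r; exists (fun j => c j * z); split=> [j|]; first exact: pM.
      by rewrite mulr_sumr; apply: eq_bigr => j _; rewrite mulrC rmorphM; ring.
  by exists c; split=> //; rewrite addrAC subrr add0r.
have [|a aP] := @choice _ _ (fun (i : 'I_n) (c : 'I_n -> Z) => (forall j, p (c j)) /\
   rs`_i - \sum_(j < n) ZR (c j) * rs`_j \in I).
  by move=> i; apply: NP; rewrite -[_`_i]mulr1; apply: fiber_comb.
pose M : 'M[Z]_n := \matrix_(i, j) a i j.
pose D := \det (1%:M - M).
have DI x : ZR D * x \in I.
  have [c ->] := rs_gen x; rewrite mulr_sumr.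
  apply: (big_ind (fun x => x \in I)) => // i _; rewrite mulrCA; apply: IM => //.
  have := @det_annihilates R n (map_mx ZR (1%:M - M)) (\col_j rs`_j) [set` I] (submod_ideal I).
  rewrite det_map_mx => /(_ _ i); rewrite mxE; apply => {}i.
  have [_ h] := aP i; rewrite map_mxB map_mx1 mulmxBl mul1mx 3!mxE /=.
  rewrite mxE; under eq_bigr do rewrite !mxE.
  exact: h.
have pD1 : p (D - 1) by apply: det_sub_ideal => // i j; rewrite mxE; case: (aP i).
have pDD : p D by apply: Ip; rewrite -[ZR D]mulr1.
apply: p1; have -> : 1 = D + -1 * (D - 1) by ring.
by apply: pD => //; apply: pM.
Qed.

(* [W / N] is a complement of [q / N] in the vector space [R / N] over [Z / p]. *)
Lemma complement_exists : submod setT q -> (forall x, N x -> q x) ->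
  exists W : set R, [/\ submod (range ZR) W, forall x, q x -> W x -> N x
    & forall x, addset q W x].
Proof.
move=> hq Nq; pose A := range ZR.
have [q0 qD qM] := hq; have [N0 ND NM] := submod_fiber.
have hqA : submod A q by apply: submod_sub hq.
have H (s : seq R) : exists W : set R, [/\ submod A W, forall x, q x -> W x -> N x
    & {in s, forall x, addset q W x}].
  elim: s => [|r s [W [hW qW sW]]].
    exists [set 0]; split=> // [|x _ -> //]; split=> // [x y -> ->|a x _ ->].
      by rewrite addr0.
    by rewrite mulr0.
  have [W0 WD WM] := hW.
  have hqW : submod A (addset q W) by apply: submod_addset.
  have [rqW|nrqW] := pselect (addset q W r).
    by exists W; split=> // x; rewrite inE => /orP[/eqP ->|/sW].
  have WW' : W `<=` addset W (scaleset A r).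
    by apply: subset_addl; exists 0; rewrite ?mul0r //; exists 0; rewrite ?rmorph0.
  exists (addset W (scaleset A r)); split.
  - apply: submod_addset => //; apply: submod_scaleset.
    split=> [|_ _ [x _ <-] [y _ <-]|_ _ [x _ <-] [y _ <-]].
    + by exists 0; rewrite ?rmorph0.
    + by exists (x + y); rewrite ?rmorphD.
    + by exists (x * y); rewrite ?rmorphM.
  - move=> x qx [w [_ [Ww [_ [z _ <-] <-] e]]].
    (* For [z] outside [p], hence invertible modulo [p], the relation could be solved for [r],
       placing it in [q + W]. *)
    have pz : p z.
      apply: contrapT => /pmax[u [t [pt ut]]]; apply: nrqW.
      have -> : r = ZR u * (w + ZR z * r) + (ZR t * r + ZR (- u) * w).
        by rewrite -[LHS]mul1r -(rmorph1 ZR) -ut rmorphD rmorphM rmorphN; ring.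
      case: (hqW) => _ qWD _; apply: (qWD).
        by apply: subset_addl => //; apply: qM; rewrite -?e.
      apply: qWD; first by apply: subset_addl => //; apply/Nq/fiber_p.
      by apply: subset_addr => //; apply: WM => //; exists (- u).
    rewrite e; apply: ND; last exact: fiber_p.
    apply: qW => //; have -> : w = (w + ZR z * r) + -1 * (ZR z * r) by ring.
    by apply: qD; rewrite -?e //; apply: qM => //; apply/Nq/fiber_p.
  - move=> x; rewrite inE => /orP[/eqP ->|/sW[y [w [qy Ww ->]]]].
      exists 0, r; rewrite add0r; split=> //; exists 0, r; rewrite add0r; split=> //.
      by exists 1; rewrite ?mul1r //; exists 1; rewrite ?rmorph1.
    by exists y, w; split=> //; apply: WW'.
have [W [hW qW sW]] := H rs; exists W; split=> // x; have [c ->] := rs_gen x.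
have [s0 sD sM] := submod_addset hqA hW.
elim/big_ind: _ => // i _; apply: sM; first by exists (c i).
exact/sW/mem_nth.
Qed.


(* Averaging a [Z]-linear retraction of [R/N] onto [q/N] with the separability
   element makes it [R]-linear, so [q/N] is generated by an idempotent. *)
Lemma separable_idempotent : separable_algebra (quot_map ZR I) ->
  submod setT q -> (forall x, N x -> q x) ->
  exists2 e, q e & forall y, q y -> N (e * y - y).
Proof.
move=> sep hq Nq; have [W [hW qW sW]] := complement_exists hq Nq.
have [q0 qD qM] := hq; have [N0 ND NM] := submod_fiber; have [W0 WD WM] := hW.
have qB x y : q x -> q y -> q (x - y) := @submodB _ _ _ x y (@subring_setT R) hq.
have NB x y : N x -> N y -> N (x - y) := @submodB _ _ _ x y (@subring_setT R) submod_fiber.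
have rA : subring (range ZR).
  split=> [|_ _ [x _ <-] [y _ <-]|_ _ [x _ <-] [y _ <-]].
  - by exists 1; rewrite ?rmorph1.
  - by exists (x - y); rewrite ?rmorphB.
  - by exists (x * y); rewrite ?rmorphM.
have WB x y : W x -> W y -> W (x - y) := @submodB _ _ _ x y rA hW.
(* [rho] projects to [q] along [W]. It is determined only modulo [N], so its linearity is stated
   after [piC]. *)
have [|rho rhoP] := @choice _ _ (fun x r => q r /\ W (x - r)).
  by move=> x; have [r [w [qr Ww ->]]] := sW x; exists r; split; rewrite // addrC addKr.
pose NI : ideal R := @submod_span R R^o N.
pose C := quot NI; pose piC x : C := \pi_(quot NI) x.
have piCE x y : piC x = piC y <-> N (x - y).
  by rewrite -(span_ideal (x - y) submod_fiber); apply: quot_eq.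
have piCD x y : piC (x + y) = piC x + piC y by apply: quot_piD.
have piCM x y : piC (x * y) = piC x * piC y by apply: quot_piMr.
have piC0 : piC 0 = 0 by apply: (addrI (piC 0)); rewrite -piCD !addr0.
have piC1 : piC 1 = 1 by apply: quot_pi1.
have piCsum (T : Type) (s : seq T) F : piC (\sum_(i <- s) F i) = \sum_(i <- s) piC (F i).
  exact: quot_pi_sum.
have rhoq x : q (rho x) by case: (rhoP x).
have rhoE x r : q r -> W (x - r) -> piC (rho x) = piC r.
  move=> qr Wr; apply/piCE; apply: qW; first exact: qB.
  have -> : rho x - r = (x - r) - (x - rho x) by ring.
  by apply: WB => //; case: (rhoP x).
have rho_id x : q x -> piC (rho x) = piC x by move=> qx; apply: rhoE; rewrite ?subrr.
have rhoD x y : piC (rho (x + y)) = piC (rho x) + piC (rho y).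
  rewrite -piCD; apply: rhoE; first exact: qD.
  have -> : x + y - (rho x + rho y) = (x - rho x) + (y - rho y) by ring.
  by apply: WD; [case: (rhoP x)|case: (rhoP y)].
have rhoZ z x : piC (rho (ZR z * x)) = piC (ZR z) * piC (rho x).
  rewrite -piCM; apply: rhoE; first exact: qM.
  by rewrite -mulrBr; apply: WM; [exists z|case: (rhoP x)].
have rhoN x : N x -> piC (rho x) = 0.
  by move=> Nx; rewrite rho_id; [rewrite -[RHS]piC0; apply/piCE; rewrite subr0|apply: Nq].
have rho_cong x y : N (x - y) -> piC (rho x) = piC (rho y).
  by move=> Nxy; rewrite -[x](subrK y) rhoD rhoN ?add0r.
pose B := quot I; pose k (b : B) : C := piC (repr b).
have kpi x : k (\pi_(quot I) x) = piC x.
  by apply/piCE/fiber_I/quot_repr.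
have kD b c : k (b + c) = k b + k c.
  have [x ->] := quot_surj b; have [y ->] := quot_surj c.
  by rewrite -quot_piD !kpi piCD.
have kM b c : k (b * c) = k b * k c.
  have [x ->] := quot_surj b; have [y ->] := quot_surj c.
  by rewrite -quot_piMr !kpi piCM.
have k0 : k 0 = 0 by apply: (addrI (k 0)); rewrite -kD !addr0.
have repr_cong b x y : b = \pi_(quot I) x -> piC (rho (repr b * y)) = piC (rho (x * y)).
  move=> ->; apply: rho_cong; rewrite -mulrBl mulrC; apply: fiber_comb.
  exact/fiber_I/quot_repr.
(* The extension of [b ⊗ c |-> b * rho (c * x)] to lists; [Z]-linearity of [rho] makes it depend
   only on the tensor. *)
pose av (s : seq (B * B)) x : C := \sum_(p <- s) k p.1 * piC (rho (repr p.2 * x)).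
have avP s t x : tensor_eqv (quot_map ZR I) (quot_map ZR I) s t -> av s x = av t x.
  rewrite /av; elim=> {s t} //.
  - by move=> s t u _ -> _ ->.
  - by move=> s s' t t' _ ss' _ tt'; rewrite !big_cat /= ss' tt'.
  - by move=> s t; rewrite !big_cat /= addrC.
  - by move=> c; rewrite big_seq1 big_nil /= k0 mul0r.
  - by move=> b b' c; rewrite !big_cons !big_nil /= !addr0 kD mulrDl.
  - move=> b c c'; rewrite !big_cons !big_nil /= !addr0 -mulrDr; congr (_ * _).
    have [u ->] := quot_surj c; have [v ->] := quot_surj c'.
    by rewrite -(quot_piD I) !(repr_cong _ _ _ erefl) mulrDl rhoD.
  - move=> a b c; rewrite !big_seq1 /= kM.
    have [z ->] := quot_surj a; have [u ->] := quot_surj c.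
    rewrite quot_mapE kpi -(quot_piMr I) !(repr_cong _ _ _ erefl) -[ZR z * u * x]mulrA rhoZ.
    by rewrite [piC (ZR z) * _]mulrC mulrA.
have [s [s1 sE]] := separability_element sep.
have avM r x : av s (r * x) = piC r * av s x.
  have := avP _ _ x (sE (\pi_(quot I) r)); rewrite /av !big_map /=.
  under eq_bigr do rewrite kM kpi -mulrA.
  rewrite -mulr_sumr => ->; apply: eq_bigr => -[b c] _ /=; congr (_ * _).
  have [u ->] := quot_surj c; rewrite -(quot_piMr I) !(repr_cong _ _ _ erefl).
  by rewrite mulrCA mulrA.
(* A lift of [av s 1]; the trailing [* 1] keeps the shape of [av]. For [y] in [q], multiplying by
   [y] gives [av s y], where [rho] fixes the multiples of [y], and [s1] leaves [y]. *)
exists (\sum_(p <- s) repr p.1 * rho (repr p.2 * 1)).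
  by elim/big_ind: _ => // -[b c] _; apply: qM.
move=> y qy; apply/piCE; rewrite piCM mulrC piCsum.
under eq_bigr do rewrite piCM.
rewrite -/(av s 1) -avM mulr1 /av.
rewrite (eq_bigr (fun i => k (i.1 * i.2) * piC y)) => [|i _]; last first.
  by rewrite rho_id ?piCM ?kM ?mulrA //; apply: qM.
rewrite -mulr_suml -(big_morph k kD k0) s1.
have -> : k 1 = piC 1 by rewrite -kpi.
by rewrite -piCM mul1r.
Qed.

(** Dual-basis coordinates are linear over [Z / a], so a relation in [R / I] holds coordinatewise;
    [z] and [w] lift the coordinates of [x] and [y]. This is the form in which flatness is used. *)
Lemma projective_cancel c d x y : projective (restrict (quot_map ZR I)) ->
  ZR c * x - ZR d * y \in I ->
  exists z w : 'I_(size rs) -> Z, (forall j, ZR (c * z j - d * w j) \in I) /\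
    x - \sum_j ZR (z j) * rs`_j \in I.
Proof.
move=> proj h.
have [b|v [vE vM]] := projective_dual_basis (g := fun j : 'I_(size rs) => \pi_(quot I) rs`_j) proj.
  have [x' ->] := quot_surj b; have [c' ->] := rs_gen x'.
  exists (fun j => \pi_(quot (contraction ZR I)) (c' j)).
  rewrite quot_pi_sum.
  by apply: eq_bigr => j _; rewrite quot_piMr -quot_mapE.
have {}vM (z : Z) b j : v (\pi_(quot I) (ZR z) * b) j = \pi_(quot (contraction ZR I)) z * v b j.
  by rewrite -vM -quot_mapE.
pose pa z := \pi_(quot (contraction ZR I)) z.
exists (fun j => repr (v (\pi_(quot I) x) j)), (fun j => repr (v (\pi_(quot I) y) j)).
split=> [j|].
  rewrite rmorphB.
  change (ZR (c * repr (v (\pi_(quot I) x) j)) -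
    ZR (d * repr (v (\pi_(quot I) y) j)) \in I).
  have e : pa (c * repr (v (\pi_(quot I) x) j)) = pa (d * repr (v (\pi_(quot I) y) j)).
    rewrite /pa !quot_piMr !reprK -!vM -!quot_piMr; congr (v _ j).
    exact/quot_eq.
  by move/quot_eq: e; rewrite /in_mem /= /contraction rmorphB.
apply/quot_eq; rewrite [LHS]vE.
rewrite quot_pi_sum.
apply: eq_bigr => j _; rewrite quot_piMr -quot_mapE; congr (quot_map _ _ _ * _).
by rewrite reprK.
Qed.

End Etale.

(** * Finite modules and integrality *)

Section FiniteModules.
Variables (A B : comNzRingType) (f : {rmorphism A -> B}).
Implicit Types (s : seq B) (N : set B).

Lemma subring_range : subring (range f).
Proof.
split=> [|_ _ [x _ <-] [y _ <-]|_ _ [x _ <-] [y _ <-]].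
- by exists 1; rewrite ?rmorph1.
- by exists (x - y); rewrite ?rmorphB.
- by exists (x * y); rewrite ?rmorphM.
Qed.

Definition lincomb s : set B :=
  [set x | exists c : 'I_(size s) -> A, x = \sum_(i < size s) f (c i) * s`_i].

Lemma lincomb_nil : lincomb [::] = [set 0].
Proof.
apply/seteqP; split=> [_ [c ->]|_ ->]; first by rewrite big_ord0.
by exists (fun=> 0); rewrite big_ord0.
Qed.

Lemma lincomb_cons g s x : lincomb (g :: s) x <-> exists z y, lincomb s y /\ x = f z * g + y.
Proof.
split=> [[c ->]|[z [_ [[c ->] ->]]]].
  exists (c ord0), (\sum_(i < size s) f (c (lift ord0 i)) * s`_i).
  by split; [exists (fun i => c (lift ord0 i))|rewrite big_ord_recl].
exists (fun i => if unlift ord0 i is Some j then c j else z).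
rewrite big_ord_recl unlift_none; congr (_ + _).
by apply: eq_bigr => i _; rewrite liftK.
Qed.

Lemma submod_lincomb s : submod (range f) (lincomb s).
Proof.
split=> [|_ _ [c ->] [d ->]|_ _ [a _ <-] [c ->]].
- by exists (fun=> 0); rewrite big1 // => i _; rewrite rmorph0 mul0r.
- exists (fun i => c i + d i); rewrite -big_split.
  by apply: eq_bigr => i _; rewrite rmorphD mulrDl.
- exists (fun i => a * c i); rewrite mulr_sumr.
  by apply: eq_bigr => i _; rewrite rmorphM mulrA.
Qed.

Lemma lincomb_mem s x : x \in s -> lincomb s x.
Proof.
elim: s => // g s IH; rewrite inE => /orP[/eqP ->|/IH sx]; apply/lincomb_cons.
  exists 1, 0; rewrite rmorph1 mul1r addr0; split=> //.
  by case: (submod_lincomb s).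
by exists 0, x; rewrite rmorph0 mul0r add0r.
Qed.

Lemma lincomb_min s N : submod (range f) N -> {in s, forall x, N x} -> lincomb s `<=` N.
Proof.
move=> [N0 ND NM] sN _ [c ->]; elim/big_ind: _ => // i _.
by apply: NM; [exists (c i)|apply/sN/mem_nth].
Qed.

(** Induction on [s]: the coefficients of [g] in elements of [N] form a finitely generated ideal.
    The list [ws] lifts its generators to [N], and [t] generates the part of [N] without [g]. *)
Lemma noetherian_lincomb s N : noetherian A -> submod (range f) N -> N `<=` lincomb s ->
  exists2 t, {in t, forall x, N x} & N `<=` lincomb t.
Proof.
move=> noeth; elim: s N => [|g s IH] N hN Ns.
  by exists [::]; [|exact: Ns].
have [N0 ND NM] := hN; have [s0 sD sM] := submod_lincomb s.
have hI : submod setT [set z | exists y, lincomb s y /\ N (f z * g + y)].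
  split=> [|x y [u [su Nu]] [v [sv Nv]]|a x _ [u [su Nu]]].
  - by exists 0; rewrite rmorph0 mul0r add0r.
  - exists (u + v); split; first exact: sD.
    by rewrite rmorphD mulrDl addrACA; apply: ND.
  - exists (f a * u); split; first by apply: sM => //; exists a.
    by rewrite rmorphM -mulrA -mulrDr; apply: NM => //; exists a.
have [zs zsP zsG] := noetherian_fg noeth hI.
have [||t tN tG] := IH (N `&` lincomb s); [exact: submodI (submod_lincomb s)|by move=> x []|].
have [|y yP] := @choice _ _ (fun (i : 'I_(size zs)) y => lincomb s y /\ N (f zs`_i * g + y)).
  by move=> i; apply/zsP/mem_nth.
pose ws := [seq f zs`_(i : 'I_(size zs)) * g + y i | i <- enum 'I_(size zs)].
exists (ws ++ t) => [x|x Nx].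
  rewrite mem_cat => /orP[/mapP[i _ ->]|/tN[]//]; by case: (yP i).
have /lincomb_cons[z [u [su ex]]] := Ns x Nx.
have [|c cE] := zsG z; first by exists u; rewrite -ex.
have hW := submod_lincomb (ws ++ t); have [W0 WD WM] := hW.
have cat1 : lincomb ws `<=` lincomb (ws ++ t).
  by apply: lincomb_min => // v vw; apply: lincomb_mem; rewrite mem_cat vw.
have cat2 : lincomb t `<=` lincomb (ws ++ t).
  by apply: lincomb_min => // v vt; apply: lincomb_mem; rewrite mem_cat vt orbT.
pose v := \sum_(i < size zs) f (c i) * (f zs`_i * g + y i).
have wsi (i : 'I_(size zs)) : f zs`_i * g + y i \in ws by apply: map_f; rewrite mem_enum.
have Wv : lincomb ws v.
  have [w0 wD wM] := submod_lincomb ws.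
  by rewrite /v; elim/big_ind: _ => // i _; apply: wM; [exists (c i)|apply: lincomb_mem].
have Nv : N v.
  by rewrite /v; elim/big_ind: _ => // i _; apply: NM; [exists (c i)|case: (yP i)].
have -> : x = v + (x - v) by ring.
apply: WD; first exact: cat1.
apply/cat2/tG; split; first exact: submodB subring_range hN _ _.
have -> : x - v = u - \sum_i f (c i) * y i.
  rewrite /v; under eq_bigr do rewrite mulrDr mulrA -rmorphM.
  rewrite big_split /= -mulr_suml -rmorph_sum -cE ex; ring.
apply: (submodB subring_range (submod_lincomb s)) => //.
elim/big_ind: _ => // i _; apply: sM; first by exists (c i).
by case: (yP i).
Qed.

End FiniteModules.

Section Integrality.
Variables (A B : comNzRingType) (f : {rmorphism A -> B}).

(** The determinant of [x - M] kills every generator, hence [1]. *)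
Lemma integral_lincomb s (x : B) : (forall y, lincomb f s y) ->
  exists2 p : {poly A}, p \is monic & (map_poly f p).[x] = 0.
Proof.
move=> gen; set n := size s.
have [|a aE] := @choice _ _ (fun (i : 'I_n) (c : 'I_n -> A) =>
    x * s`_i = \sum_(j < n) f (c j) * s`_j).
  by move=> i; apply: gen.
pose M := \matrix_(i, j) a i j : 'M[A]_n.
exists (char_poly M); first exact: char_poly_monic.
rewrite map_char_poly.
have -> : (char_poly (map_mx f M)).[x] = \det (x%:M - map_mx f M).
  rewrite /char_poly -[LHS]/(horner_eval x _) -det_map_mx; congr (\det _).
  by apply/matrixP => i j; rewrite !mxE /= /horner_eval !(hornerE, hornerMn).
have h0 : submod [set: B] [set 0].
  by split=> // [_ _ -> ->|b _ _ ->]; rewrite ?addr0 ?mulr0.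
have ann := @det_annihilates B n (x%:M - map_mx f M) (\col_j s`_j) _ h0.
have [c c1] := gen 1; rewrite -[LHS]mulr1 c1 mulr_sumr big1 // => i _.
have {ann}-> : \det (x%:M - map_mx f M) * (f (c i) * s`_i) = f (c i) * 0.
  rewrite mulrCA; congr (_ * _); rewrite -[RHS](ann _ i) ?mxE // => k.
  rewrite mulmxBl mul_scalar_mx !mxE aE; apply/eqP; rewrite subr_eq0; apply/eqP.
  by apply: eq_bigr => j _; rewrite !mxE.
by rewrite mulr0.
Qed.

(** While the constant coefficient vanishes, the regular [x] is cancelled from the equation;
    monicity ensures that this stops at a nonzero coefficient. *)
Lemma monic_root_lreg (p : {poly A}) (x : B) : GRing.lreg x -> p \is monic ->
  (map_poly f p).[x] = 0 -> exists z r, z != 0 /\ f z = x * r.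
Proof.
move=> xreg; elim/poly_ind: p => [|p c IH]; first by rewrite monicE lead_coef0 eq_sym oner_eq0.
rewrite rmorphD rmorphM /= map_polyX map_polyC !hornerE => mon e.
have [c0|c0] := eqVneq c 0; last first.
  exists c, (- (map_poly f p).[x]); split=> //.
  by move/eqP: e; rewrite addrC addr_eq0 => /eqP ->; rewrite mulrN mulrC.
have {}e : (map_poly f p).[x] * x + f c = 0 by exact: e.
move: mon e; rewrite c0 polyC0 addr0 rmorph0 addr0 => mon e; apply: IH.
  by move: mon; rewrite !monicE lead_coefMX.
by apply: xreg; rewrite mulr0 mulrC.
Qed.

End Integrality.

Lemma image_prodset (A B : comNzRingType) (f : {rmorphism A -> B}) (X Y : set A) :
  f @` prodset X Y = prodset (f @` X) (f @` Y).
Proof.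
apply/seteqP; split=> [_ [z + <-]|].
  elim=> [|x y t Xx Yy _ IH]; first by rewrite rmorph0; apply: Prodset0.
  by rewrite rmorphD rmorphM; apply: ProdsetD => //.
apply: prodset_ind' => [|_ _ [x Px <-] [y Py <-]|_ _ [x Xx <-] [y Yy <-]].
- by exists 0; [apply: Prodset0|rewrite rmorph0].
- by exists (x + y); [apply: prodsetD|rewrite rmorphD].
- by exists (x * y); [apply: prodset_mul|rewrite rmorphM].
Qed.

Section Images.
Variables (A B C : comNzRingType) (f : {rmorphism A -> B}) (g : {rmorphism B -> C}).

Lemma image_powprod X m : f @` powprod setT X m = powprod (range f) (f @` X) m.
Proof. by elim: m => //= m IH; rewrite image_prodset IH. Qed.

Lemma submod_image (N : set A) : submod setT N -> submod (range f) (f @` N).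
Proof.
move=> [N0 ND NM]; split=> [|_ _ [x Nx <-] [y Ny <-]|_ _ [a _ <-] [x Nx <-]].
- by exists 0; rewrite ?rmorph0.
- by exists (x + y); rewrite ?rmorphD //; apply: ND.
- by exists (a * x); rewrite ?rmorphM //; apply: NM.
Qed.

Lemma extension_prodset (I : ideal A) :
  [set` extension f I] = @prodset B setT (f @` ([set` I] : set A)).
Proof.
apply/seteqP; split=> x /=.
  move: x; apply: submod_span_ind => [|x y|b x fx].
  - exact: Prodset0.
  - exact: prodsetD.
  - exact: prodset_mul.
elim=> [|b y z _ fy _ IH]; first exact: (rpred0 (extension f I)).
apply: (rpredD (S := extension f I)) => //.
by apply: (@rpredZ _ _ (extension f I) b); apply: submod_span_sub.
Qed.

Lemma image_extension (I : ideal A) :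
  g @` [set` extension f I] = prodset (range g) ((g \o f) @` [set` I]).
Proof.
rewrite extension_prodset.
have -> : (g \o f) @` [set` I] = g @` (f @` [set` I]) by rewrite image_comp.
exact: (image_prodset g).
Qed.

Lemma lincomb_preimage (s : seq B) y :
  lincomb (g \o f) [seq g x | x <- s] y -> exists2 x, y = g x & lincomb f s x.
Proof.
elim: s y => [|x s IH] y /=.
  by rewrite !lincomb_nil => ->; exists 0; rewrite ?rmorph0.
move=> /lincomb_cons[z [t [/IH[u -> su] ->]]]; exists (f z * x + u).
  by rewrite rmorphD rmorphM.
by apply/lincomb_cons; exists z, u.
Qed.

Lemma seq_preimage (t : seq C) : {in t, forall x, range g x} -> exists s, t = [seq g x | x <- s].
Proof.
elim: t => [|x t IH] tg; first by exists [::].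
have [|s ->] := IH; first by move=> y yt; apply: tg; rewrite inE yt orbT.
by have [y _ <-] := tg x (mem_head _ _); exists (y :: s).
Qed.

End Images.

Lemma invertible_prodset (R Q : comNzRingType) (j : {rmorphism R -> Q}) (I : ideal R) :
  invertible (ideal_image j I) ->
  exists J, prodset (j @` [set` I]) J = range j.
Proof.
move=> [J HJ].
have hJ : submod (range j) [set` J].
  split=> [|x y xJ yJ|_ x [a _ <-] xJ]; first exact: (rpred0 J).
    exact: (rpredD (S := J)).
  exact: (@rpredZ _ _ J a).
exists [set` J]; apply/seteqP; split.
  move=> x Px; suff /HJ[r ->] : x \in submod_mul (ideal_image j I) J by exists r.
  elim: Px => [|a y z Ia Jy _ IH]; first exact: (rpred0 (submod_mul (ideal_image j I) J)).
  apply: (rpredD (S := submod_mul (ideal_image j I) J)) => //.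
  by apply: submod_span_sub; exists a; [apply: submod_span_sub|exists y].
move=> _ [r _ <-]; have /HJ : exists r', j r = j r' by exists r.
move: (j r) => x; move: x; have [P0 PD PM] := submod_prodset (j @` [set` I]) hJ.
apply: (submod_span_ind
  (P := prodset (j @` [set` I]) [set` J] : set (restrict j))) => // a _ [x + [y yJ <-]].
move: x.
change (forall x, x \in ideal_image j I ->
  prodset (j @` [set` I]) [set` J] (j a * (x * y))).
move=> x xI; apply: (PM); first by exists a.
move: x xI; apply: (submod_span_ind (P :=
  (fun x => prodset (j @` [set` I]) [set` J] (x * y)) : set (restrict j))) => [|x x' Px Px'|b _ [x xI <-]].
- by rewrite mul0r.
- by rewrite mulrDl; apply: (PD).
- change (prodset (j @` [set` I]) [set` J] (j b * j x * y)).
  by rewrite -mulrA; apply: PM; [exists b|apply: prodset_mul => //; exists x].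
Qed.

Lemma module_finite_lincomb (A B : comNzRingType) (f : {rmorphism A -> B}) :
  module_finite (restrict f) -> exists s : seq B, forall x, lincomb f s x.
Proof. by move=> [s sP]; exists s => x; have [c ->] := submod_span_seq (sP x); exists c. Qed.

Lemma common_denominator (R Q : comNzRingType) (j : {rmorphism R -> Q}) (s : seq Q) :
  is_total_fractions j ->
  exists2 c, GRing.lreg c & {in s, forall x, exists r, j c * x = j r}.
Proof.
move=> [_ _ frac]; elim: s => [|x s [c creg cs]].
  by exists 1 => //; apply: lreg1.
have [r [d [dreg e]]] := frac x; exists (c * d); first exact: lregM.
move=> y; rewrite inE => /orP[/eqP ->|/cs[t et]].
  by exists (c * r); rewrite !rmorphM -mulrA e.
by exists (d * t); rewrite !rmorphM -et mulrAC mulrC.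
Qed.

Lemma dedekind_comaximal (Z : idomainType) (p : set Z) c : dedekind Z -> primeset p ->
  c != 0 -> p c -> forall z, ~ p z -> exists w t, p t /\ w * z + t = 1.
Proof.
move=> dedZ hp c0 pc z npz; have [hpm p1 _] := hp.
have hM : submod setT (addset p (scaleset setT z)).
  by apply/submod_addset/submod_scaleset.
have [|nM1] := pselect (addset p (scaleset setT z) 1).
  by move=> [t [_ [pt [w _ <-] ->]]]; exists w, t; rewrite addrC.
have [q Mq /maximal_prime hq] := maximal_ideal_above hM nM1.
exfalso; apply: npz; apply: (dedekind_prime_max dedZ hp hq c0 pc).
  by move=> x px; apply: Mq; apply: subset_addl => //; exists 0; rewrite ?mul0r.
by apply: Mq; apply: subset_addr; [case: hpm|exists 1; rewrite ?mul1r].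
Qed.

(** * Divisibility of the local exponents *)

Section Exponents.
Variables (Z : idomainType) (R S Q : comNzRingType).
Variables (ZR : {rmorphism Z -> R}) (RS : {rmorphism R -> S}) (SQ : {rmorphism S -> Q}).
Hypotheses (RS_inj : injective RS) (SQ_inj : injective SQ).
Hypothesis Q_frac : is_total_fractions (SQ \o RS).
Hypothesis Z_dedekind : dedekind Z.
Variable gs : seq S.
Hypothesis gs_gen : forall x, lincomb (RS \o ZR) gs x.

(** [R] is a [Z]-submodule of the Noetherian module [S]. *)
Lemma base_generators : exists rs : seq R, forall x, lincomb ZR rs x.
Proof.
have noeth : noetherian Z by case: Z_dedekind.
have hN : submod (range (RS \o ZR)) (range RS).
  split=> [|_ _ [x _ <-] [y _ <-]|_ _ [a _ <-] [x _ <-]].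
  - by exists 0; rewrite ?rmorph0.
  - by exists (x + y); rewrite ?rmorphD.
  - by exists (ZR a * x); rewrite ?rmorphM.
have [|t tR tG] := @noetherian_lincomb _ _ (RS \o ZR) gs (range RS) noeth hN.
  by move=> x _; apply: gs_gen.
have [rs et] := seq_preimage tR; exists rs => x.
have := tG (RS x); rewrite et => /(_ (ex_intro2 _ _ x Logic.I erefl)).
by move=> /lincomb_preimage[y /RS_inj ->].
Qed.

(* A common denominator [c] of generators of [S] is regular and integral over [Z],
   and the last nonzero coefficient of an equation of [c] is a multiple of [c]. *)
Lemma conductor_nonzero : exists2 z, z != 0 & forall x : S, exists r, RS (ZR z) * x = RS r.
Proof.
have [c creg cgs] := common_denominator [seq SQ g | g <- gs] Q_frac.
have [p pmon pc] := integral_lincomb (RS c) gs_gen.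
have pcR : (map_poly ZR p).[c] = 0.
  by apply: RS_inj; rewrite rmorph0 -horner_map -map_poly_comp.
have [z [r [z0 zr]]] := monic_root_lreg creg pmon pcR.
exists z => // x.
have hR : submod (range (RS \o ZR)) [set x | exists r, RS (ZR z) * x = RS r].
  split=> [|a b [u eu] [v ev]|_ b [a _ <-] [u eu]] /=.
  - by exists 0; rewrite mulr0 rmorph0.
  - by exists (u + v); rewrite mulrDr eu ev rmorphD.
  - by exists (ZR a * u); rewrite mulrCA eu rmorphM.
apply: (lincomb_min hR) (gs_gen x) => g gg /=.
have [u eu] := cgs (SQ g) (map_f _ gg).
exists (r * u); rewrite zr !rmorphM; apply: SQ_inj.
by rewrite [RS c * _]mulrC -mulrA !rmorphM -[SQ (RS u)]eu.
Qed.

Variable I : ideal R.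
Hypothesis I_etale : finite_etale (quot_map ZR I).
Variable J : set Q.
Hypothesis IJ : prodset ((SQ \o RS) @` [set` I]) J = range (SQ \o RS).
Variables (b : ideal S) (m : nat).
Hypotheses (m_gt0 : (0 < m)%N) (Ib : extension RS I =i ideal_exp b m).

Variables (p : set Z) (pi s : Z) (e : nat).
Hypotheses (hp : primeset p) (hpi : uniformizer p pi s).
Hypothesis contr_gen : exists2 u, ~ p u & ZR (u * pi ^+ e) \in I.
Hypothesis contr_div : forall y, ZR y \in I -> exists t w, ~ p t /\ t * y = w * pi ^+ e.
Hypothesis p_nonzero : exists2 x, p x & x != 0.
Hypothesis e_gt0 : (0 < e)%N.

Let Zs := range (SQ \o RS \o ZR).
Let Rs := range (SQ \o RS).
Let Ss := range SQ.
Let Is := (SQ \o RS) @` [set` I].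
Let piQ := SQ (RS (ZR pi)).

Let pmul z y : p y -> p (z * y).
Proof. by case: hp => -[_ _ pM] _ _; apply: pM. Qed.

Let pi_neq0 : pi != 0.
Proof.
have [ppi nps hs] := hpi; have [x px x0] := p_nonzero; have [w ew] := hs x px.
apply/eqP => pi0; move/eqP: ew; rewrite pi0 mul0r mulf_eq0 (negPf x0) orbF => /eqP s0.
by apply: nps; rewrite s0; case: hp => -[].
Qed.

Let p_max z : ~ p z -> exists w t, p t /\ w * z + t = 1.
Proof. by have [x px x0] := p_nonzero; apply: dedekind_comaximal x0 px _. Qed.

Let contr_sub z : ZR z \in I -> p z.
Proof.
have [ppi _ _] := hpi; have [_ _ pP] := hp.
move=> /contr_div[t [w [npt ew]]]; have : p (t * z).
  by rewrite ew -(prednK e_gt0) exprSr mulrA; apply: pmul.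
by case/pP.
Qed.

Section AtPrime.
Variable rs : seq R.
Hypothesis rs_gen : forall x, lincomb ZR rs x.
Variable q : set R.
Hypotheses (hq : primeset q) (Nq : fiber_ideal ZR I p `<=` q).

Let T := (SQ \o RS) @` (~` q).
Let TZ := (SQ \o RS \o ZR) @` (~` p).

Let q_contr z : q (ZR z) -> p z.
Proof.
move=> qz; apply: contrapT => /p_max[w [t [pt wt]]].
have [[q0 qD qM] q1 _] := hq; apply: q1.
rewrite -(rmorph1 ZR) -wt rmorphD rmorphM; apply: qD; first exact: qM.
by apply: Nq; rewrite -[ZR t]mulr1; apply: fiber_p.
Qed.

Let hRs : subring Rs. Proof. exact: subring_range. Qed.
Let hZs : subring Zs. Proof. exact: subring_range. Qed.
Let hSs : subring Ss. Proof. exact: subring_range. Qed.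
Let RsSs : Rs `<=` Ss. Proof. by move=> _ [x _ <-]; exists (RS x). Qed.
Let ZsRs : Zs `<=` Rs. Proof. by move=> _ [x _ <-]; exists (ZR x). Qed.
Let TR : T `<=` Rs. Proof. by move=> _ [x _ <-]; exists x. Qed.
Let TZs : TZ `<=` Zs. Proof. by move=> _ [x _ <-]; exists x. Qed.
Let TZT : TZ `<=` T.
Proof. by move=> _ [x npx <-]; exists (ZR x) => // /q_contr. Qed.

Let mulset_image (A B : comNzRingType) (f : {rmorphism A -> B}) (N : set A) :
  mulset N -> mulset (f @` N).
Proof.
move=> [N1 NM]; split=> [|_ _ [x Nx <-] [y Ny <-]]; first by exists 1; rewrite ?rmorph1.
by exists (x * y); rewrite ?rmorphM //; apply: NM.
Qed.

Let hT : mulset T. Proof. exact/mulset_image/mulset_prime. Qed.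
Let hTZ : mulset TZ. Proof. exact/mulset_image/mulset_prime. Qed.
Let hIs : submod Rs Is. Proof. exact/submod_image/submod_ideal. Qed.
Let IsRs : Is `<=` Rs. Proof. by move=> _ [x _ <-]; exists x. Qed.
Let RpiQ : Rs piQ. Proof. by exists (ZR pi). Qed.

Let qT x : Rs x -> ((SQ \o RS) @` q) x \/ T x.
Proof. by move=> [r _ <-]; have [qr|nqr] := pselect (q r); [left|right]; exists r. Qed.

Let fiber_powset x : fiber_ideal ZR I p x ->
  powset Rs piQ Is 1 (SQ (RS (ZR s)) * SQ (RS x)).
Proof.
have [_ _ hs] := hpi.
have [P0 PD PM] := submod_powset hRs piQ 1 hIs.
move=> [a [i [Pa Ii ->]]]; rewrite !rmorphD mulrDr; apply: (PD); last first.
  apply: (PM); first by exists (ZR s).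
  by apply: subset_powset => //; exists i.
move: a Pa; apply: (@prodset_ind' _ _ _
    (fun a => powset Rs piQ Is 1 (SQ (RS (ZR s)) * SQ (RS a)))).
- by rewrite !rmorph0 mulr0.
- by move=> c d Pc Pd; rewrite !rmorphD mulrDr; apply: (PD).
move=> _ y [z pz <-] _; have [w ew] := hs z pz.
rewrite !rmorphM mulrA -!rmorphM ew mulrC !rmorphM.
have -> : SQ (RS y) * (SQ (RS (ZR pi)) * SQ (RS (ZR w))) =
    SQ (RS (y * ZR w)) * piQ ^+ 1 by rewrite expr1 /piQ !rmorphM; ring.
apply: (PM); last exact: powset_pow.
by exists (y * ZR w).
Qed.

Lemma len_quotient : len_is Rs T Is Rs e.
Proof.
have [proj sep] := I_etale; have [hqm q1 qP] := hq; have [q0 qD qM] := hqm.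
(* As [ep] lies in [q] and acts as [1] on [q] modulo the fibre, [1 - ep] is outside [q] and kills
   [q] there; the factor [s] then trades [p] for [pi]. *)
have qp : lsub T ((SQ \o RS) @` q) (powset Rs piQ Is 1).
  move=> _ [y qy <-]; have [ep qe ye] := separable_idempotent rs_gen p_max sep hqm Nq.
  have [_ nps _] := hpi.
  exists (SQ (RS (ZR s * (1 - ep)))).
    exists (ZR s * (1 - ep)) => // /qP[/q_contr //|h]; apply: q1.
    by rewrite -[1](subrK ep); apply: qD.
  have -> : SQ (RS (ZR s * (1 - ep))) * (SQ \o RS) y = SQ (RS (ZR s)) * SQ (RS ((1 - ep) * y)).
    by rewrite /= !rmorphM mulrA.
  apply: fiber_powset.
  have -> : (1 - ep) * y = - 1 * (ep * y - y) by ring.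
  exact/fiber_comb/ye.
(* The layer from [I] to [I + pi^e R] has length 0, since [u * pi ^+ e] lies in [I] with [u] outside
   [q]. *)
rewrite -[e]add0n; apply: (@len_is_add _ Rs T hRs TR hT _ (powset Rs piQ Is e)) => //.
- exact: submod_powset.
- exact: subring_submod.
- exact: subset_powset.
- apply: (addset_min (subring_submod hRs)) => // _ [r Rr <-].
  have [_ _ RM] := hRs; apply: (RM) => //.
  by elim: (e) => [|n IH]; rewrite ?expr0 ?exprS; [case: hRs|apply: (RM)].
- apply: len_is0; first exact: subset_powset.
  have [u npu uI] := contr_gen; have [I0 ID IM] := hIs.
  move=> _ [x [_ [Ix [r Rr <-] ->]]]; exists (SQ (RS (ZR u))).
    by exists (ZR u) => // /q_contr.
  rewrite mulrDr; apply: ID; first by apply: IM => //; exists (ZR u).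
  rewrite mulrCA; apply: IM => //.
  by exists (ZR (u * pi ^+ e)) => //=; rewrite !rmorphM !rmorphXn.
apply: (len_is_powset hRs TR hT RpiQ qT hIs IsRs qp) => i _ ie [x nqx <-].
move=> [_ [_ [[y yI <-] [_ [r _ <-] <-] eq]]]; apply: nqx.
have {}eq : ZR (pi ^+ i) * x - ZR (pi ^+ i.+1) * r \in I.
  suff -> : ZR (pi ^+ i) * x - ZR (pi ^+ i.+1) * r = y by [].
  apply: RS_inj; apply: SQ_inj; move: eq; rewrite /= /piQ => eq.
  rewrite !rmorphB !rmorphM !rmorphXn mulrC eq; ring.
have [z [w [zw xz]]] := projective_cancel rs_gen proj eq.
(* [pi^i (z j - pi * w j)] has valuation at least [e > i], so [z j] lies in [p]. Then [x] lies in
   [pR + I], hence in [q], a contradiction. *)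
have pz j : p (z j).
  have [t [v [npt ev]]] := contr_div (zw j).
  have [ppi _ _] := hpi; have [[p0 pD pM] _ pP] := hp.
  have pii0 : pi ^+ i != 0 by apply: expf_neq0.
  have E : t * (z j - pi * w j) = v * pi ^+ (e - i.+1) * pi.
    apply: (mulfI pii0); rewrite -[v * _ * pi]mulrA -exprSr -subSn // subSS.
    have -> : pi ^+ i * (v * pi ^+ (e - i)) = v * pi ^+ e.
      by rewrite mulrCA -exprD subnKC // ltnW.
    by rewrite -ev exprS; ring.
  have : p (t * (z j - pi * w j)) by rewrite E; apply: pmul.
  case/pP => // pzw; have -> : z j = (z j - pi * w j) + w j * pi by ring.
  by apply: pD => //; apply: pmul.
have -> : x = (x - \sum_j ZR (z j) * rs`_j) + \sum_j ZR (z j) * rs`_j by ring.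
apply: (qD); first exact/Nq/fiber_I.
elim/big_ind: _ => // j _; exact/Nq/fiber_p.
Qed.

(** With [z S] inside [R], the quotient [S/zS] bounds [S/R]. Over [Z] at [p] its length is at most
    the number of generators of [S] times the valuation [k] of [z]. *)
Lemma len_conductor : exists k, len_le Rs T Rs Ss k.
Proof.
have [z z0 zS] := conductor_nonzero.
have [k [t [u [npt npu e0]]]] := uniformizer_decomp Z_dedekind hp hpi z0.
pose h x := SQ (RS (ZR x)).
have ZpiQ : Zs piQ by exists pi.
have N0 : submod Zs [set 0].
  by split=> // [_ _ -> ->|a _ _ ->]; rewrite ?addr0 ?mulr0.
have N0Zs : [set 0] `<=` Zs by move=> _ ->; apply: subring0.
have hpT x : Zs x -> ((SQ \o RS \o ZR) @` p) x \/ TZ x.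
  by move=> [r _ <-]; have [pr|npr] := pselect (p r); [left|right]; exists r.
have [ppi nps hs] := hpi.
have powE n r : powset Zs piQ [set 0] n (h r * piQ ^+ n).
  by apply: subset_addr => //; exists (h r) => //; exists r.
have hpp : lsub TZ ((SQ \o RS \o ZR) @` p) (powset Zs piQ [set 0] 1).
  move=> _ [x px <-]; have [w ew] := hs x px; exists (h s); first by exists s.
  rewrite /h /= -!rmorphM ew mulrC !rmorphM -[SQ (RS (ZR pi))]expr1; exact: powE.
have lenZ : len_le Zs TZ (powset Zs piQ [set 0] k) Zs k :=
  @len_le_powset _ _ _ hZs TZs hTZ _ ZpiQ _ _ hpT N0 N0Zs hpp k.
pose K := scaleset Zs (h z).
have hZsm := subring_submod hZs.
have KZ : K `<=` Zs by move=> _ [_ [a _ <-] <-]; exists (a * z); rewrite //= !rmorphM.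
(* [K] contains [u pi^k Z]. The summand [0] is for the layer up to [pi^k Z], trivial because [u] is
   outside [p]; [k] is for the rest. *)
have lenK : len_le Zs TZ K Zs (0 + k).
  move=> n /(chain_subl (N := scaleset Zs (h u * piQ ^+ k))) c.
  have {}c : chain Zs TZ (scaleset Zs (h u * piQ ^+ k)) Zs n.
    apply: c => _ [_ [a _ <-] <-]; exists (h (a * t)); first by exists (a * t).
    by rewrite /h /piQ -!rmorphXn -!rmorphM -[a * t * z]mulrA e0 !rmorphM.
  apply: (len_le_add hZs TZs hTZ (P := powset Zs piQ [set 0] k)) c => //.
  - exact: submod_scaleset.
  - exact: submod_powset.
  - by move=> _ [_ [a _ <-] <-]; rewrite mulrA -!rmorphM; apply: powE.
  - apply: (addset_min hZsm) => // _ [_ [a _ <-] <-].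
    by exists (a * pi ^+ k) => //=; rewrite !rmorphM !rmorphXn.
  have [||_ h0] := @len_is0 _ Zs TZ (scaleset Zs (h u * piQ ^+ k))
    (powset Zs piQ [set 0] k); last exact: h0.
    by move=> _ [_ [a _ <-] <-]; rewrite mulrA -!rmorphM; apply: powE.
  move=> _ [_ [_ [-> [_ [a _ <-] <-] ->]]]; exists (h u); first by exists u.
  by exists (h a); [exists a|rewrite add0r /h /=; ring].
pose N := scaleset Ss (h z).
have hN : submod Zs N.
  by apply: submod_scaleset; apply: submod_sub (subring_submod hSs) => x /ZsRs/RsSs.
pose gq := [seq SQ g | g <- gs].
have lenG : len_le Zs TZ N (genset Zs N gq) (size gq * (0 + k)).
  apply: (len_le_genset hZs TZs hTZ hN lenK KZ) => _ /mapP[x _ ->] _ [_ [a _ <-] <-].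
  exists (SQ (RS (ZR a) * x)); first by exists (RS (ZR a) * x).
  by rewrite /h rmorphM /=; ring.
exists (size gq * (0 + k))%N => n c; apply: lenG.
have {}c := chain_restrict ZsRs TZT c.
have NR : N `<=` Rs.
  move=> _ [_ [x _ <-] <-]; have [r er] := zS x; exists r => //.
  by rewrite /= -er rmorphM mulrC.
apply: chain_subr (chain_subl NR c) => _ [x _ <-].
have [c' ->] := gs_gen x; rewrite rmorph_sum.
have [G0 GD GM] := submod_genset hZs gq hN.
elim/big_ind: _ => // i _; rewrite rmorphM; apply: GM; first by exists (c' i).
have : SQ gs`_i \in gq by apply/map_f/mem_nth.
elim: gq {G0 GD} => // y l IH; rewrite inE => /orP[/eqP <-|/IH Gt] /=.
  apply: subset_addr; first by case: (submod_genset hZs l hN).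
  by exists 1; rewrite ?mul1r //; case: hZs.
by apply: subset_addl => //; exists 0; rewrite ?mul0r //; apply: subring0.
Qed.

Lemma len_dvd : (m %| e)%N.
Proof.
have [k fin] := len_conductor.
pose Bs := SQ @` [set` b].
have hB : submod Ss Bs by apply/submod_image/submod_ideal.
have BS : Bs `<=` Ss by move=> _ [x _ <-]; exists x.
apply: (length_dvd hRs hSs RsSs TR hT hIs IsRs IJ fin len_quotient hB BS m_gt0).
rewrite -image_extension /Ss /Bs -image_powprod; congr (_ @` _).
apply/seteqP; split=> x /=; rewrite Ib; first by move/in_ideal_exp.
by move=> h; apply/in_ideal_exp.
Qed.

End AtPrime.

(** A suitable [q] exists: [e > 0] puts the contraction of [I] inside [p], and [R] is finite over
    [Z], so [pR + I] is proper. *)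
Lemma exponent_dvd : (m %| e)%N.
Proof.
have [rs rs_gen] := base_generators.
have hpm : submod setT p by case: hp.
have nN1 : ~ fiber_ideal ZR I p 1.
  by apply: (fiber_proper rs_gen hpm contr_sub); case: hp.
have [q Nq /maximal_prime hq] := maximal_ideal_above (submod_fiber ZR I p) nN1.
exact: len_dvd rs_gen _ hq Nq.
Qed.

End Exponents.

Theorem theorem1p3 (Z : idomainType) (R S Q : comNzRingType)
    (ZR : {rmorphism Z -> R}) (RS : {rmorphism R -> S})
    (SQ : {rmorphism S -> Q})
    (ZR_inj : injective ZR) (RS_inj : injective RS) (SQ_inj : injective SQ)
    (Q_frac : is_total_fractions (SQ \o RS))
    (Z_dedekind : dedekind Z)
    (S_finite : module_finite (restrict (RS \o ZR)))
    (I : ideal R)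
    (I_invertible : invertible (ideal_image (SQ \o RS) I))
    (m : nat)
    (I_etale : finite_etale (quot_map ZR I)) :
  (exists b : ideal S, extension RS I =i ideal_exp b m) ->
  exists b : ideal Z, contraction ZR I =i ideal_exp b m.
Proof.
move=> [b Ib]; have [gs gs_gen] := module_finite_lincomb S_finite.
have hI := submod_ideal I.
have [m0|m_gt0] := posnP m.
  pose top : ideal Z := unit_ideal Z; exists top => x; rewrite m0 /=.
  suff I1 : 1 \in I.
    suff xI : ZR x \in I by rewrite -[RHS]/true; exact: xI.
    by rewrite -[ZR x]mulr1; case: hI => _ _; apply.
  have S_gen y : exists c : 'I_(size gs) -> R, y = \sum_(i < size gs) RS (c i) * gs`_i.
    by have [c ->] := gs_gen y; exists (fun i => ZR (c i)).
  apply: contrapT => nI1.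
  have hS0 : submod setT [set 0 : S].
    by split=> // [_ _ -> ->|? _ _ ->]; rewrite ?addr0 ?mulr0.
  pose zero : ideal S := @submod_span S S^o [set 0].
  have zeroE y : y \in zero -> y = 0 by move=> /(span_ideal y hS0).
  (* The determinant trick for the finite extension [RS], with [I] in the role of [p] and the zero
     ideal in that of [I]: a proper [I] cannot generate the unit ideal of [S]. *)
  apply: (@fiber_proper R S RS zero gs S_gen [set` I] hI) => //.
    move=> z /zeroE zR0; have -> : z = 0 by apply: RS_inj; rewrite zR0 rmorph0.
    by case: hI.
  have : [set` extension RS I] (1 : S) by rewrite /= Ib m0.
  rewrite extension_prodset prodsetC; apply: subset_addl; exact: (rpred0 zero).
have [J IJ] := invertible_prodset I_invertible.
have hc : submod setT [set` contraction ZR I] := submod_ideal _.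
(* A zero contraction has no local exponents; it is the [m]-th power of the zero ideal since
   [m > 0]. *)
have [nz|zero] := pselect (exists2 x, [set` contraction ZR I] x & x != 0); last first.
  have h0 : submod setT [set 0 : Z].
    by split=> // [_ _ -> ->|? _ _ ->]; rewrite ?addr0 ?mulr0.
  pose b0 : ideal Z := @submod_span Z Z^o [set 0].
  have b0E : [set` b0] = [set 0] by apply/seteqP; split=> x /(span_ideal x h0).
  exists b0 => x; apply/idP/idP => [xI|/in_ideal_exp].
    have -> : x = 0 by apply: contrapT => /eqP x0; apply: zero; exists x.
    exact: (rpred0 (ideal_exp b0 m)).
  case: m m_gt0 {Ib} => // m' _; rewrite b0E => xP.
  have : [set 0] x.
    move: x xP; by apply: prodset_ind' => // [_ _ -> ->|_ y -> _]; rewrite ?addr0 ?mul0r.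
  by move=> ->; exact: (rpred0 (contraction ZR I)).
have [|b' b'E] := ideal_root Z_dedekind m_gt0 hc nz.
  move=> p pi s e hp hpi gen dvd; have [->|e_gt0] := posnP e; first exact: dvdn0.
  have np : exists2 x, p x & x != 0.
    have [x xI x0] := nz; exists x => //; have [t [w [npt ew]]] := dvd x xI.
    have [[_ _ pM] _ pP] := hp; have [ppi _ _] := hpi.
    have : p (t * x) by rewrite ew -(prednK e_gt0) exprSr mulrA; apply: pM.
    by case/pP.
  exact: (exponent_dvd RS_inj SQ_inj Q_frac Z_dedekind gs_gen I_etale IJ m_gt0 Ib
    hp hpi gen dvd np e_gt0).
by exists b' => x; apply/idP/idP => /b'E.
Qed.
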